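(* Let $C$ be a free curve in $\mathbb{P}^2$, of degree $d\ge 3$, with exponents $(d_1,d_2)$ such that $d_1=1$. Then any irreducible component of $C$ is a rational curve.
   Context: Let $S=\mathbb{C}[x,y,z]$ and let $C:f=0$ be a reduced curve of degree $d$ in the complex projective plane $\mathbb{P}^2$, with $f\in S$ homogeneous of degree $d$. Let $$D_0(C)=\{(a,b,c)\in S^3: af_x+bf_y+cf_z=0\}$$ be the graded $S$-module of Jacobian syzygies, where $f_x,f_y,f_z$ are the partial derivatives of $f$; a homogeneous syzygy $(a,b,c)$ has degree $k$ if $a,b,c$ are homogeneous of degree $k$. The curve $C$ is called free if $D_0(C)$ is a free $S$-module; it is then of rank 2, and the degrees $d_1\le d_2$ of a homogeneous basis are called the exponents of $C$. *)

(* Defs.v *)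
From mathcomp Require Export all_boot all_order all_algebra.
From mathcomp Require Export reals complex.
From mathcomp Require Export mpoly.

Set Implicit Arguments.
Unset Strict Implicit.
Unset Printing Implicit Defensive.

Import GRing.Theory.
Local Open Scope ring_scope.

Definition divides (A : comNzRingType) (g p : A) : Prop := exists q, p = q * g.

Definition squarefree (A : comUnitRingType) (f : A) : Prop :=
  forall h : A, divides (h ^+ 2) f -> h \is a GRing.unit.

Definition irreducible (A : comUnitRingType) (g : A) : Prop :=
  [/\ g != 0, g \isn't a GRing.unit &
      forall a b : A, g = a * b -> a \is a GRing.unit \/ b \is a GRing.unit].

Definition reduced_curve (K : fieldType) (d : nat) (f : {mpoly K[3]}) : Prop :=
  [/\ f != 0, f \is d.-homog & squarefree f].

(* D_0(C), as a predicate on S^3: the triples killed by the gradient of f. *)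
Definition jacobian_syzygy (K : fieldType) (f : {mpoly K[3]})
    (r : 'rV[{mpoly K[3]}]_3) : Prop :=
  \sum_(i < 3) r 0 i * f^`M(i) = 0.

Definition homog_of_degree (K : fieldType) (k : nat)
    (r : 'rV[{mpoly K[3]}]_3) : Prop :=
  forall i, r 0 i \is k.-homog.

Definition is_basis (A : nzRingType) (V : lmodType A) (M : V -> Prop)
    (n : nat) (b : 'I_n -> V) : Prop :=
  [/\ forall i, M (b i),
      forall v, M v -> exists c : 'I_n -> A, v = \sum_i c i *: b i &
      forall c : 'I_n -> A, \sum_i c i *: b i = 0 -> forall i, c i = 0].

(* S is Noetherian, so a basis of a submodule of S^3 is necessarily finite. *)
Definition free_curve (K : fieldType) (f : {mpoly K[3]}) : Prop :=
  exists (n : nat) (b : 'I_n -> 'rV[{mpoly K[3]}]_3),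
    is_basis (jacobian_syzygy f) b.

Definition has_exponents (K : fieldType) (f : {mpoly K[3]}) (d1 d2 : nat) :
    Prop :=
  (d1 <= d2)%N /\
  exists b : 'I_2 -> 'rV[{mpoly K[3]}]_3,
    [/\ is_basis (jacobian_syzygy f) b,
        homog_of_degree d1 (b ord0) & homog_of_degree d2 (b ord_max)].

(* The component g = 0 of f = 0. *)
Definition irreducible_component (K : fieldType) (f g : {mpoly K[3]}) : Prop :=
  [/\ exists e, g \is e.-homog, irreducible g & divides g f].

(* Below, g in n variables stands for the subvariety V(g) of P^(n-1), where g
   is homogeneous and is either irreducible or 0 (V(0) being P^(n-1) itself),
   so that over an algebraically closed field the multiples of g are exactly
   the polynomials vanishing on V(g). *)

(* F defines a rational map from V(g) to V(h): its entries are forms of a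
   common degree, not all vanishing identically on V(g), and h vanishes on the
   image. *)
Definition rational_map (K : fieldType) (n m : nat) (g : {mpoly K[n]})
    (h : {mpoly K[m]}) (F : m.-tuple {mpoly K[n]}) : Prop :=
  [/\ exists e, forall i, tnth F i \is e.-homog,
      exists i, ~ divides g (tnth F i) &
      divides g (h \mPo F)].

(* H is defined on a dense open subset of V(g) and is the identity there:
   (H_0 : ... : H_(n-1)) = (X_0 : ... : X_(n-1)). *)
Definition generic_identity (K : fieldType) (n : nat) (g : {mpoly K[n]})
    (H : n.-tuple {mpoly K[n]}) : Prop :=
  (exists i, ~ divides g (tnth H i)) /\
  forall i j, divides g (tnth H i * 'X_j - tnth H j * 'X_i).

Definition comp_tuple (K : fieldType) (n m k : nat)
    (G : k.-tuple {mpoly K[m]}) (F : m.-tuple {mpoly K[n]}) :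
    k.-tuple {mpoly K[n]} :=
  [tuple tnth G i \mPo F | i < k].

Definition birational (K : fieldType) (n m : nat) (g : {mpoly K[n]})
    (h : {mpoly K[m]}) : Prop :=
  exists (F : m.-tuple {mpoly K[n]}) (G : n.-tuple {mpoly K[m]}),
    [/\ rational_map g h F, rational_map h g G,
        generic_identity g (comp_tuple G F) &
        generic_identity h (comp_tuple F G)].

(* Birational to the projective line. *)
Definition rational_curve (K : fieldType) (g : {mpoly K[3]}) : Prop :=
  birational g (0 : {mpoly K[2]}).

(* Main.v *)
Require Import Defs.
From HB Require Import structures.
From mathcomp Require Import fingroup perm zify ring.
From Stdlib Require Import Classical.

(** A syzygy of degree 1 is a vector field with linear coefficients that kills f;
let M be its matrix.  By Euler's formula M is not scalar, since a nonzero multiple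
of the Euler field does not kill f.  If g is an irreducible factor of f, then g
divides the derivative of f along the field; as g is prime and f is squarefree, g
divides its own derivative, which has the same degree, so that g is an eigenvector
of the field ([linear_field_eigen]).  Geometrically, the one-parameter group of M
preserves the curve g = 0, which is therefore the closure of an orbit or a line
of fixed points.

After a linear change of coordinates, M is in one of two normal forms
([linear_normal_form]).  If M is diagonal, the eigenvalue equation puts all the
monomials of g on one line of the lattice of exponents.  Either g is a single
monomial, hence a coordinate line, or the curve is the closure of an orbit of the
one-dimensional torus orthogonal to this line, parametrized by
(s^p t^r : c s^(p+r) : t^(p+r)) with p and r coprime
([parametrized_monomial_curve]).  If M is not diagonalizable, g is
also killed by a nilpotent field X_0 d_1 + c X_1 d_2 ([jordan_eigen_nilpotent]), and
its curve is a coordinate line or the closure of an orbit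
(s^2 : s t : a s^2 + c t^2 / 2) of the unipotent group of that field
([parametrized_nilpotent]).

In all cases there are forms G in two variables with g(G) = 0 and forms F in three
variables with F(G) proportional to the identity.  Such a pair is a birational
equivalence with the projective line as soon as every polynomial vanishing at G is a
multiple of g ([parametrization_kernel]).  If P vanishes at G and is prime to g,
elimination of one variable gives a nonzero polynomial in the other two that vanishes
at G ([mpoly_elimination]); but two of the entries of G are algebraically
independent by the Jacobian criterion ([jacobian_alg_indep]), since the Jacobian of
F(G) is a combination of the Jacobians of pairs of entries of G.

The primality of g and the elimination both rest on unique factorization in
polynomial rings, obtained by induction on the number of variables
([factorial_poly], [factorial_mpoly]). *)

Set Implicit Arguments.
Unset Strict Implicit.
Unset Printing Implicit Defensive.

Import GRing.Theory Num.Theory.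
Local Open Scope ring_scope.

(** * Unique factorization in polynomial rings *)

Section Factorial.
Context (A : idomainType).
Implicit Types (a b p q x y z : A) (s : seq A).

Definition prime_elt p :=
  [/\ p != 0, p \isn't a GRing.unit &
      forall a b, divides p (a * b) -> divides p a \/ divides p b].

(** Unique factorization, in the form of the existence of a factorization into primes:
such a factorization is automatically unique, and the existence passes to
polynomial rings. *)
Definition factorial_ring :=
  forall a, a != 0 -> exists u s,
    [/\ u \is a GRing.unit, forall p, p \in s -> prime_elt p &
        a = u * \prod_(p <- s) p].

Lemma divides_mull p a b : divides p a -> divides p (b * a).
Proof. by case=> q ->; exists (b * q); rewrite mulrA. Qed.

Lemma dividesD p a b : divides p a -> divides p b -> divides p (a + b).
Proof. by move=> [q ->] [q' ->]; exists (q + q'); rewrite mulrDl. Qed.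

Lemma divides_unitl u p a : u \is a GRing.unit -> divides (u * p) a <-> divides p a.
Proof.
move=> Uu; split=> -[q ->].
  by rewrite mulrA; exists (q * u).
by exists (q / u); rewrite mulrA divrK.
Qed.

(** Each prime of the product divides one of the two factors, so the primes can be
shared out between x and y, and then cancelled. *)
Lemma prod_primes_split s x y z :
    (forall p, p \in s -> prime_elt p) -> x * y = (\prod_(p <- s) p) * z ->
  exists s1 s2 x0 y0,
    [/\ perm_eq s (s1 ++ s2), x = (\prod_(p <- s1) p) * x0,
        y = (\prod_(p <- s2) p) * y0 & z = x0 * y0].
Proof.
elim: s x y => [|p s IHs] x y prs.
  rewrite big_nil mul1r => xyz; exists [::], [::], x, y.
  by rewrite !big_nil !mul1r.
have [p0 _ prp] : prime_elt p by apply: prs; rewrite mem_head.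
have {}prs q : q \in s -> prime_elt q by move=> qs; apply: prs; rewrite inE qs orbT.
rewrite big_cons -mulrA => xyz.
have : divides p (x * y) by rewrite xyz; exists ((\prod_(j <- s) j) * z); rewrite mulrC.
case/prp=> -[w wE]; subst.
- have /IHs[//|s1 [s2 [x0 [y0 [ps -> -> ->]]]]] : w * y = \prod_(j <- s) j * z.
    by apply: (mulfI p0); rewrite -xyz mulrCA mulrA.
  exists (p :: s1), s2, x0, y0; split=> //=; first by rewrite perm_cons.
  by rewrite big_cons mulrC mulrA.
- have /IHs[//|s1 [s2 [x0 [y0 [ps -> -> ->]]]]] : x * w = \prod_(j <- s) j * z.
    by apply: (mulfI p0); rewrite -xyz mulrC mulrA.
  exists s1, (p :: s2), x0, y0; split=> //=.
    by rewrite perm_sym -[p :: s2]cat1s perm_catCA /= perm_cons perm_sym.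
  by rewrite big_cons mulrC mulrA.
Qed.

(** An irreducible product of primes has only one prime factor. *)
Lemma irreducible_prod_primes u s :
    u \is a GRing.unit -> (forall p, p \in s -> prime_elt p) ->
  irreducible (u * \prod_(p <- s) p) -> prime_elt (u * \prod_(p <- s) p).
Proof.
move=> Uu prs [n0 nU irr].
case: s prs n0 nU irr => [|p s] prs n0 nU irr.
  by rewrite big_nil mulr1 Uu in nU.
have [p0 pU prp] : prime_elt p by apply: prs; rewrite mem_head.
rewrite big_cons [p * _]mulrC mulrA in n0 nU irr *.
have [Uv|] := irr _ _ erefl; last by rewrite (negPf pU).
split=> // a b /(divides_unitl _ _ Uv) /prp[]; rewrite -(divides_unitl p _ Uv); tauto.
Qed.

Lemma factorial_irreducible_prime p :
  factorial_ring -> irreducible p -> prime_elt p.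
Proof.
move=> fA irr; have [p0 _ _] := irr.
have [u [s [Uu prs pE]]] := fA _ p0; rewrite pE in irr *.
exact: irreducible_prod_primes.
Qed.

End Factorial.

Section FactorialPoly.
Context (A : idomainType).
Implicit Types (c p : A) (f g h : {poly A}).

(** If p divides f g then it divides the product of the leading coefficients, hence one
of them; removing that leading term from its polynomial keeps the hypothesis and
decreases the degree. *)
Lemma prime_polyC p : prime_elt p -> prime_elt p%:P.
Proof.
case=> p0 pU prp; split; first by rewrite polyC_eq0.
  by rewrite poly_unitE size_polyC p0 coefC eqxx.
move=> f g; have [n] := ubnP (size f + size g).
elim: n f g => // n IHn f g lt_n [q fgE].
have [->|f0] := eqVneq f 0; first by left; exists 0; rewrite mul0r.
have [->|g0] := eqVneq g 0; first by right; exists 0; rewrite mul0r.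
have drop_lead h : h != 0 ->
    exists2 h' : {poly A}, (size h' < size h)%N & h = h' + lead_coef h *: 'X^((size h).-1).
  move=> h0; exists (\poly_(i < (size h).-1) h`_i).
    by apply: leq_ltn_trans (size_poly _ _) _; rewrite ltn_predL lt0n size_poly_eq0.
  have Sh : (0 < size h)%N by rewrite lt0n size_poly_eq0.
  apply/polyP=> i; rewrite coefD coef_poly coefZ coefXn lead_coefE.
  case: ltngtP => [lt_i|lt_i|->]; rewrite ?mulr0 ?addr0 ?mulr1 ?add0r //.
  by rewrite nth_default // -(prednK Sh).
have addC c k h : divides p c -> divides p%:P h -> divides p%:P (h + c *: 'X^k).
  move=> [d ->] [h' ->]; exists (h' + d *: 'X^k).
  by rewrite mulrDl -!mul_polyC polyCM [in RHS]mulrAC.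
have : divides p (lead_coef f * lead_coef g).
  by exists (lead_coef q); rewrite -lead_coefM fgE lead_coefM lead_coefC.
case/prp=> -[d dE].
- have [f' lt_f' fE] := drop_lead f f0.
  have : divides p%:P (f' * g).
    exists (q - d *: 'X^((size f).-1) * g).
    have -> : f' = f - d%:P * p%:P * 'X^((size f).-1).
      by rewrite {1}fE dE -mul_polyC polyCM addrK.
    by rewrite mulrBl fgE -mul_polyC; ring.
  case/IHn=> [|pf'|]; last by right.
    by rewrite -ltnS; apply: leq_trans lt_n; rewrite ltnS ltn_add2r.
  by left; rewrite fE; apply: addC => //; exists d.
- have [g' lt_g' gE] := drop_lead g g0.
  have : divides p%:P (f * g').
    exists (q - d *: 'X^((size g).-1) * f).
    have -> : g' = g - d%:P * p%:P * 'X^((size g).-1).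
      by rewrite {1}gE dE -mul_polyC polyCM addrK.
    by rewrite mulrBr fgE -mul_polyC; ring.
  case/IHn=> [|?|pg']; first 1 last; first by left.
    by right; rewrite gE; apply: addC => //; exists d.
  by rewrite -ltnS; apply: leq_trans lt_n; rewrite ltnS ltn_add2l.
Qed.

Context (factA : factorial_ring A).

Lemma prod_polyC (s : seq A) : \prod_(p <- map polyC s) p = (\prod_(p <- s) p)%:P.
Proof. by rewrite big_map rmorph_prod. Qed.

Lemma prime_map_polyC (s : seq A) :
  (forall p, p \in s -> prime_elt p) ->
  forall q, q \in map (@polyC A) s -> prime_elt q.
Proof. by move=> prs _ /mapP[p /prs ps ->]; apply: prime_polyC. Qed.

(** Gauss's lemma: the primes of a constant factor remain prime among the polynomials,
so a constant that divides a product can be cancelled against the two factors. *)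
Lemma const_mul_split c f g h : c != 0 -> c%:P * f = g * h ->
  exists c1 c2 g0 h0,
    [/\ c1 != 0, c2 != 0, g = c1%:P * g0, h = c2%:P * h0 & f = g0 * h0].
Proof.
move=> /factA[u [s [Uu prs ->]]]; rewrite polyCM -mulrA => fgh.
have UuP : u%:P \is a GRing.unit by rewrite rmorph_unit.
have s_neq0 (r : seq A) : {subset r <= s} -> \prod_(p <- r) p != 0.
  move=> rs; rewrite prodf_seq_neq0; apply/allP=> p /rs /prs[] p0 _ _.
  by rewrite p0.
have : ((u%:P)^-1 * g) * h = (\prod_(p <- map polyC s) p) * f.
  by rewrite prod_polyC -mulrA -fgh mulKr.
case/(prod_primes_split (prime_map_polyC prs))=> t1 [t2 [g0 [h0 [pst gE hE ->]]]].
have sub_map (t : seq {poly A}) : {subset t <= map polyC s} ->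
    exists2 r, {subset r <= s} & t = map polyC r.
  elim: t => [|q t IHt] ts; first by exists [::].
  have /mapP[p ps ->] := ts q (mem_head _ _).
  have [|r rs ->] := IHt; first by move=> x xt; apply: ts; rewrite inE xt orbT.
  by exists (p :: r) => // x; rewrite inE => /predU1P[->|/rs].
have [|r1 /s_neq0 r1_0 E1] := sub_map t1.
  by move=> x xt; rewrite (perm_mem pst) mem_cat xt.
have [|r2 /s_neq0 r2_0 E2] := sub_map t2.
  by move=> x xt; rewrite (perm_mem pst) mem_cat xt orbT.
exists (u * \prod_(p <- r1) p), (\prod_(p <- r2) p), g0, h0; split=> //.
- by rewrite mulf_neq0 //; apply: contraTneq Uu => ->; rewrite unitr0.
- by rewrite polyCM -mulrA -prod_polyC -E1 -gE mulVKr.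
- by rewrite -prod_polyC -E2.
Qed.

(** An irreducible f of positive degree has no constant factor, so that a constant that
f divides out of is cancelled entirely against the cofactor. *)
Lemma irreducible_divides_const c f g :
    irreducible f -> (1 < size f)%N -> c != 0 ->
  divides f (c%:P * g) -> divides f g.
Proof.
move=> [f0 fU irr] sf c0 [k /(const_mul_split c0)].
move=> [c1 [c2 [k0 [h0 [_ c20 _ fE ->]]]]].
have [Uc|] := irr _ _ fE; first by rewrite fE; exists (k0 / c2%:P); rewrite mulrA divrK.
rewrite poly_unitE => /andP[sh0 _].
by move: sf; rewrite fE mul_polyC size_scale // (eqP sh0).
Qed.

(** Over the field of fractions the gcd of f and g is either a constant, and a Bezout
relation cleared of its denominators gives r, or it has positive degree, and then it
is associated to f up to constants because f is irreducible. *)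
Lemma irreducible_elimination f g : irreducible f ->
  divides f g \/ exists r h k, r != 0 /\ r%:P = h * f + k * g.
Proof.
move=> irr; have [f0 fU irrf] := irr.
have [[h k] /=] := Bezoutp f g; set e := gcdp f g => /eqpP[[c1 c2] /= /andP[c10 c20]].
move=> bez; have e0 : e != 0 by rewrite gcdp_eq0 negb_and f0.
have [se|se] := leqP (size e) 1.
  right; exists (c2 * e`_0), (c1 *: h), (c1 *: k); split.
    by rewrite mulf_neq0 //; move: e0; rewrite (size1_polyC se) polyC_eq0 coefC eqxx.
  by rewrite -!scalerAl -scalerDr bez {2}(size1_polyC se) -mul_polyC polyCM.
left; have /Pdiv.WeakIdomain.dvdpP[[c q] /= c0] : e %| f by apply: dvdp_gcdl.
rewrite -mul_polyC => /(const_mul_split c0)[d1 [d2 [q0 [e1 [d10 d20 qE eE fE]]]]].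
have se1 : (1 < size e1)%N by move: se; rewrite eE mul_polyC size_scale.
have [Uq|] := irrf _ _ fE; last by rewrite poly_unitE => /andP[/eqP se1'_]; rewrite se1'_ in se1.
have /Pdiv.WeakIdomain.dvdpP[[c' q'] /= c'0 gE] : e %| g by apply: dvdp_gcdr.
apply: (irreducible_divides_const irr (c := c')) => //.
  move: Uq; rewrite poly_unitE fE => /andP[/eqP sq _].
  have q00 : q0 != 0 by rewrite -size_poly_eq0 sq.
  by rewrite size_mul ?sq // -size_poly_gt0 ltnW.
exists (q' * d2%:P / q0).
by rewrite mul_polyC gE eE fE -[q' * d2%:P / q0 * _]mulrA mulKr // mulrA.
Qed.

Lemma irreducible_prime_poly f : irreducible f -> prime_elt f.
Proof.
move=> irr; have [f0 fU irrf] := irr.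
have [sf|sf] := leqP (size f) 1.
  have fE := size1_polyC sf; have c0 : f`_0 != 0 by rewrite -polyC_eq0 -fE.
  have [u [s [Uu prs cE]]] := factA c0.
  move: irr; rewrite fE cE polyCM -prod_polyC.
  apply: irreducible_prod_primes; first by rewrite rmorph_unit.
  exact: prime_map_polyC.
split=> // a b fab; have [|[r [h [k [r0 rE]]]]] := irreducible_elimination a irr.
  by left.
right; apply: (irreducible_divides_const irr sf r0).
rewrite rE mulrDl; apply: dividesD; last by rewrite -mulrA; apply: divides_mull.
by exists (h * b); rewrite mulrAC.
Qed.

(** Splitting f into two nonunits decreases the degree plus the number of prime factors
of the leading coefficient: a factor of degree 0 is a nonunit constant, so it takes
at least one of these primes. *)
Lemma factorial_poly : factorial_ring {poly A}.
Proof.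
move=> f f0; have lf0 : lead_coef f != 0 by rewrite lead_coef_eq0.
have [u [s [Uu prs fE]]] := factA lf0.
have [n] := ubnP (size f + size s)%N.
elim: n => // n IHn in f f0 u s Uu prs fE {lf0} *; rewrite ltnS => le_n.
have [fU|fU] := boolP (f \is a GRing.unit).
  by exists f, [::]; rewrite big_nil mulr1.
have [irr|] := classic (irreducible f).
  exists 1, [:: f]; rewrite unitr1 big_seq1 mul1r; split=> // p.
  by rewrite inE => /eqP->; apply: irreducible_prime_poly.
move=> nirr; have {nirr} [a [b [fab aU bU]]] :
    exists a b, [/\ f = a * b, a \isn't a GRing.unit & b \isn't a GRing.unit].
  apply: NNPP => nab; apply: nirr; split=> // a b fab.
  have [Ua|nUa] := boolP (a \is a GRing.unit); first by left.
  have [Ub|nUb] := boolP (b \is a GRing.unit); first by right.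
  by case: nab; exists a, b.
have a0 : a != 0 by apply: contraNneq f0 => a0; rewrite fab a0 mul0r.
have b0 : b != 0 by apply: contraNneq f0 => b0; rewrite fab b0 mulr0.
have : lead_coef a * lead_coef b = (\prod_(p <- s) p) * u.
  by rewrite -lead_coefM -fab fE mulrC.
case/(prod_primes_split prs)=> s1 [s2 [x0 [y0 [ps aE bE uE]]]].
have [Ux Uy] : x0 \is a GRing.unit /\ y0 \is a GRing.unit.
  by move: Uu; rewrite uE unitrM => /andP.
have measure_gt1 h (r : seq A) v : h != 0 -> v \is a GRing.unit ->
    h \isn't a GRing.unit -> lead_coef h = (\prod_(p <- r) p) * v ->
    (1 < size h + size r)%N.
  move=> h0 Uv hU hE; have := h0; rewrite -size_poly_gt0.
  case sh : (size h) => [//|[|m]] _; last by rewrite !addSn.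
  case: r hE => [|p r] hE; last by rewrite addnS.
  case/negP: hU; rewrite poly_unitE sh eqxx /=.
  by move: hE; rewrite big_nil mul1r lead_coefE sh /= => ->.
have sz : (size f + size s).+1 = (size a + size s1 + (size b + size s2))%N.
  have sab : (size a + size b = (size f).+1)%N.
    by rewrite fab size_mul // prednK // addn_gt0 size_poly_gt0 a0.
  by rewrite (perm_size ps) size_cat addnACA sab addSn.
(* The measures of the factors are at least 2 and add up to one more than that of f. *)
have ma := measure_gt1 a s1 x0 a0 Ux aU aE.
have mb := measure_gt1 b s2 y0 b0 Uy bU bE.
have [||||w [t [Uw prt aF]]] := IHn a a0 x0 s1.
- exact: Ux.
- by move=> p p1; apply: prs; rewrite (perm_mem ps) mem_cat p1.
- by rewrite aE mulrC.
- move: sz le_n mb; lia.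
have [||||w' [t' [Uw' prt' bF]]] := IHn b b0 y0 s2.
- exact: Uy.
- by move=> p p1; apply: prs; rewrite (perm_mem ps) mem_cat p1 orbT.
- by rewrite bE mulrC.
- move: sz le_n ma; lia.
exists (w * w'), (t ++ t'); split; first by rewrite unitrM Uw.
  by move=> p; rewrite mem_cat => /orP[/prt|/prt'].
by rewrite fab aF bF big_cat mulrACA.
Qed.

End FactorialPoly.

Lemma factorial_iso (A B : idomainType) (phi : {rmorphism A -> B})
    (psi : {rmorphism B -> A}) :
  cancel phi psi -> cancel psi phi -> factorial_ring B -> factorial_ring A.
Proof.
move=> phiK psiK fB a a0.
have pa0 : phi a != 0 by rewrite -(rmorph0 phi) (inj_eq (can_inj phiK)).
have [u [s [Uu prs aE]]] := fB _ pa0.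
exists (psi u), (map psi s); split; first by rewrite rmorph_unit.
  move=> _ /mapP[p /prs[p0 pU prp] ->]; split.
  - by rewrite -(rmorph0 psi) (inj_eq (can_inj psiK)).
  - by apply: contra pU => /(rmorph_unit phi); rewrite psiK.
  - move=> x y [q xyE].
    have /prp[] : divides p (phi x * phi y).
      by exists (phi q); rewrite -rmorphM xyE rmorphM psiK.
    + by case=> r rE; left; exists (psi r); rewrite -rmorphM -rE phiK.
    + by case=> r rE; right; exists (psi r); rewrite -rmorphM -rE phiK.
by rewrite big_map -rmorph_prod -rmorphM -aE phiK.
Qed.

(** * Factorization and elimination for several variables *)

Lemma mpoly_rmorph_eq n (K : nzRingType) (S : comNzRingType)
    (phi psi : {rmorphism {mpoly K[n]} -> S}) :
  (forall c, phi c%:MP = psi c%:MP) -> (forall i, phi 'X_i = psi 'X_i) ->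
  phi =1 psi.
Proof.
move=> eqC eqX; elim/mpolyind => [|c m p _ _ IHp]; first by rewrite !rmorph0.
rewrite !rmorphD IHp -mul_mpolyC !rmorphM eqC mpolyXE_id !rmorph_prod.
by congr (_ * _ + _); apply: eq_bigr => i _; rewrite !rmorphXn /= eqX.
Qed.

Lemma irreducible_iso (A B : comUnitRingType) (phi : {rmorphism A -> B})
    (psi : {rmorphism B -> A}) a :
  cancel phi psi -> cancel psi phi -> irreducible a -> irreducible (phi a).
Proof.
move=> phiK psiK [a0 aU irr]; split.
- by rewrite -(rmorph0 phi) (inj_eq (can_inj phiK)).
- by apply: contra aU => /(rmorph_unit psi); rewrite phiK.
move=> x y xyE; have /irr[] : a = psi x * psi y by rewrite -rmorphM -xyE phiK.
- by move/(rmorph_unit phi); rewrite psiK; left.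
- by move/(rmorph_unit phi); rewrite psiK; right.
Qed.

Section LastVariable.
Context (n : nat) (K : fieldType).
Implicit Types (p : {mpoly K[n.+1]}) (q : {poly {mpoly K[n]}}).

(** The inverse of [muni]: evaluation at the last variable of a polynomial whose
coefficients involve the others. *)
Definition unmuni q : {mpoly K[n.+1]} := (map_poly (@mwiden n K) q).['X_ord_max].

HB.instance Definition _ := GRing.RMorphism.copy unmuni
  (horner_eval 'X_ord_max \o map_poly (@mwiden n K)).

Lemma muni_X_max : muni ('X_ord_max : {mpoly K[n.+1]}) = 'X.
Proof.
rewrite muniE msuppX big_seq1 mcoeffX eqxx scale1r mnm1E eqxx expr1.
rewrite (_ : [multinom _ | i < n] = 0%MM) ?mpolyX0 ?scale1r //.
apply/mnmP=> i; rewrite mnmE mnm1E mnm0E -val_eqE /= eq_sym.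
by rewrite (ltn_eqF (ltn_ord i)).
Qed.

Lemma muni_X_widen (i : 'I_n) :
  muni ('X_(widen_ord (leqnSn n) i) : {mpoly K[n.+1]}) = ('X_i)%:P.
Proof.
rewrite muniE msuppX big_seq1 mcoeffX eqxx scale1r mnm1E -val_eqE /=.
rewrite (ltn_eqF (ltn_ord i)) expr0 alg_polyC.
by congr ('X_[_])%:P; apply/mnmP=> j; rewrite mnmE !mnm1E -!val_eqE.
Qed.

Lemma muni_mwiden (r : {mpoly K[n]}) : muni (mwiden r) = r%:P.
Proof.
have := @mpoly_rmorph_eq n K {poly {mpoly K[n]}} (@muni n K \o @mwiden n K)
  (@polyC {mpoly K[n]}).
move=> /(_ _ _ r); apply=> [c|i] /=.
  by rewrite mwidenC muniC.
by rewrite /mwiden mmapX mmap1U muni_X_widen.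
Qed.

Lemma unmuniK : cancel unmuni (@muni n K).
Proof.
apply: poly_ind => [|q r IHq]; first by rewrite !rmorph0.
rewrite rmorphD rmorphM /= muniD muniM IHq /unmuni map_polyC map_polyX.
by rewrite hornerC hornerX muni_X_max muni_mwiden.
Qed.

Lemma muniK : cancel (@muni n K) unmuni.
Proof.
apply: (@mpoly_rmorph_eq n.+1 K {mpoly K[n.+1]} (unmuni \o @muni n K) idfun) => [c|i] /=.
  by rewrite muniC /unmuni map_polyC hornerC /= mwidenC.
case: (unliftP ord_max i) => [j|] ->.
  have -> : lift ord_max j = widen_ord (leqnSn n) j.
    by apply: val_inj; rewrite [LHS]lift_max.
  by rewrite muni_X_widen /unmuni map_polyC hornerC /= /mwiden mmapX mmap1U.
by rewrite muni_X_max /unmuni map_polyX hornerX.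
Qed.

End LastVariable.

Lemma factorial_mpoly (K : fieldType) n : factorial_ring {mpoly K[n]}.
Proof.
elim: n => [|n IHn]; last first.
  exact: factorial_iso (@muniK n K) (@unmuniK n K) (factorial_poly IHn).
move=> a a0; exists a, [::]; split=> //; last by rewrite big_nil mulr1.
have aE : a = (a@_0%MM)%:MP by rewrite mpolyKC.
by rewrite aE rmorph_unit // unitfE; apply: contraNneq a0 => c0; rewrite aE c0.
Qed.

(** The resultant without its formula: two polynomials with no common factor generate a
nonzero polynomial free of the last variable. *)
Lemma mpoly_elimination (K : fieldType) n (f g : {mpoly K[n.+1]}) :
  irreducible f ->
  divides f g \/ exists r h k, r != 0 /\ mwiden r = h * f + k * g.
Proof.
move=> irr.
have irr' : irreducible (muni f).
  exact: (irreducible_iso (@muniK n K) (@unmuniK n K)).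
case: (irreducible_elimination (@factorial_mpoly K n) (muni g) irr').
  case=> q qE; left; exists (unmuni q).
  by apply: (can_inj (@muniK n K)); rewrite qE muniM unmuniK.
case=> r [h [k [r0 rE]]]; right; exists r, (unmuni h), (unmuni k); split=> //.
by apply: (can_inj (@muniK n K)); rewrite muni_mwiden rE muniD !muniM !unmuniK.
Qed.

Local Notation o0 := (@Ordinal 3 0 isT).
Local Notation o1 := (@Ordinal 3 1 isT).
Local Notation o2 := (@Ordinal 3 2 isT).

(** * Sums, permutations and exponents in small dimension *)

Lemma ord2_ind (P : 'I_2 -> Prop) : P ord0 -> P ord_max -> forall i, P i.
Proof.
by move=> P0 P1 [[|[|//]] i] //;
  [suff -> : Ordinal i = ord0 | suff -> : Ordinal i = ord_max]; rewrite //; exact: val_inj.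
Qed.

Lemma ord3_ind (P : 'I_3 -> Prop) : P o0 -> P o1 -> P o2 -> forall i, P i.
Proof.
move=> P0 P1 P2 [[|[|[|//]]] i]; rewrite (bool_irrelevance i isT) //.
Qed.

Lemma sum_ord2 (V : nmodType) (F : 'I_2 -> V) : \sum_(i < 2) F i = F ord0 + F ord_max.
Proof. by rewrite big_ord_recr big_ord1; congr (F _ + _); apply: val_inj. Qed.

Lemma sum_ord3 (V : nmodType) (F : 'I_3 -> V) : \sum_(i < 3) F i = F o0 + F o1 + F o2.
Proof.
rewrite !big_ord_recr big_ord0 /= add0r.
by congr (F _ + F _ + F _); apply: val_inj.
Qed.

Lemma ex_perm2 (T : finType) (a b i j : T) :
  a != b -> i != j -> exists s : {perm T}, s a = i /\ s b = j.
Proof.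
move=> ab ij; have tb : tperm a i b != i.
  by rewrite -[X in _ != X](tpermL a i) (inj_eq perm_inj) eq_sym.
(* First a is sent to i, then the image of b is sent to j. *)
exists (tperm a i * tperm (tperm a i b) j)%g.
by rewrite !permM !tpermL tpermD // eq_sym.
Qed.

Lemma prod_ord2 (A : comPzSemiRingType) (F : 'I_2 -> A) :
  \prod_(i < 2) F i = F ord0 * F ord_max.
Proof. by rewrite big_ord_recr big_ord1; congr (F _ * _); apply: val_inj. Qed.

Lemma prod_ord3 (A : comPzSemiRingType) (F : 'I_3 -> A) :
  \prod_(i < 3) F i = F o0 * F o1 * F o2.
Proof.
rewrite !big_ord_recr big_ord0 /= mul1r.
by congr (F _ * F _ * F _); apply: val_inj.
Qed.

Lemma mdeg3 (m : 'X_{1..3}) : mdeg m = (m o0 + m o1 + m o2)%N.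
Proof. by rewrite mdegE sum_ord3. Qed.

(** The differences of the exponents of m and m' add up to 0 and are not all 0, so one
of them has a sign which is opposite, in the weak sense, to those of the other two. *)
Lemma ex_increasing_pair (m m' : 'X_{1..3}) : mdeg m = mdeg m' -> m != m' ->
  exists i j, i != j /\ ((m' i < m i)%N /\ (m' j <= m j)%N \/
                         (m i < m' i)%N /\ (m j <= m' j)%N).
Proof.
rewrite !mdeg3 => degE /eqP mm'; apply: NNPP => no; apply: mm'.
have no' i j : i != j -> ~ ((m' i < m i)%N /\ (m' j <= m j)%N \/
                         (m i < m' i)%N /\ (m j <= m' j)%N).
  by move=> ij H; apply: no; exists i, j.
have n01 := no' o0 o1 isT; have n10 := no' o1 o0 isT.
have n02 := no' o0 o2 isT; have n20 := no' o2 o0 isT.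
have n12 := no' o1 o2 isT; have n21 := no' o2 o1 isT.
by apply/mnmP; apply: ord3_ind; lia.
Qed.

(** * Coefficients, substitution and the chain rule *)

Lemma mnm1_le n (i : 'I_n) (m : 'X_{1..n}) : (U_(i) <= m)%MM = (0 < m i)%N.
Proof.
apply/mnm_lepP/idP => [/(_ i)|m_i j]; first by rewrite mnm1E eqxx.
by rewrite mnm1E; case: eqP => // <-.
Qed.

Lemma mcoeff_mulX n (K : comNzRingType) (i : 'I_n) (p : {mpoly K[n]}) m :
  ('X_i * p)@_m = if (0 < m i)%N then p@_(m - U_(i)) else 0.
Proof.
rewrite mulrC; case: ifPn => [m_i|].
  have mE : (m - U_(i) + U_(i))%MM = m by rewrite submK ?mnm1_le.
  by rewrite -{1}mE addmC mcoeffMX.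
rewrite -eqn0Ngt => /eqP m_i; rewrite (mpolyE p) mulr_suml raddf_sum big1 //= => m' _.
rewrite -scalerAl -mpolyXD mcoeffZ mcoeffX; case: eqP => [E|]; last by rewrite mulr0.
by move: m_i; rewrite -E mnmDE mnm1E eqxx addn1.
Qed.

(** The monomials are eigenvectors of X_i d_i. *)
Lemma mcoeff_mulX_deriv n (K : comNzRingType) (i : 'I_n) (p : {mpoly K[n]}) m :
  ('X_i * p^`M(i))@_m = p@_m *+ m i.
Proof.
rewrite mcoeff_mulX; case: ifPn => [m_i|]; last first.
  by rewrite -eqn0Ngt => /eqP->.
by rewrite mcoeff_deriv submK ?mnm1_le // mnmBE mnm1E eqxx subn1 prednK.
Qed.

Lemma homog_coeff_neq0 n (K : nzRingType) e (g : {mpoly K[n]}) m :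
  g \is e.-homog -> g@_m != 0 -> mdeg m = e.
Proof. by move=> hg gm; have /= := dhomogP _ _ _ hg m; apply; rewrite mcoeff_msupp. Qed.

Lemma homog0_unit (K : fieldType) n (g : {mpoly K[n]}) :
  g != 0 -> g \is 0.-homog -> g \is a GRing.unit.
Proof.
move=> g0 hg; have gC : g = (g@_0%MM)%:MP.
  apply: msize1_polyC; rewrite msizeE; apply/bigmax_leqP_seq => m.
  by rewrite mcoeff_msupp => /(homog_coeff_neq0 hg) ->.
rewrite gC rmorph_unit // unitfE; apply: contraNneq g0 => c0.
by rewrite gC c0.
Qed.

Lemma homog1_linear_form (K : nzRingType) n (p : {mpoly K[n]}) :
  p \is 1.-homog -> p = \sum_j p@_U_(j) *: 'X_j.
Proof.
move=> hp; apply/mpolyP=> m; rewrite raddf_sum /=.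
under eq_bigr do rewrite mcoeffZ mcoeffX.
have [/eqP|m1] := eqVneq (mdeg m) 1%N.
  rewrite mdeg_eq1 => /existsP[i /eqP ->].
  rewrite (bigD1 i) //= eqxx mulr1 big1 ?addr0 // => j ji.
  case: eqP => [/mnmP/(_ j)|_]; last by rewrite mulr0.
  by rewrite !mnm1E eqxx eq_sym (negPf ji).
rewrite big1 => [|j _]; last first.
  by case: eqP => [E|]; rewrite ?mulr0 //; rewrite -E mdeg1 in m1.
by apply/eqP; apply: contraNT m1 => /(homog_coeff_neq0 hp) ->.
Qed.

Lemma mpoly_ring_ind n (K : comNzRingType) (P : {mpoly K[n]} -> Prop) :
    (forall c, P c%:MP) -> (forall i, P 'X_i) ->
    (forall p q, P p -> P q -> P (p + q)) ->
    (forall p q, P p -> P q -> P (p * q)) ->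
  forall p, P p.
Proof.
move=> PC PX PD PM; elim/mpolyind => [|c m p _ _ Pp]; first by rewrite -mpolyC0.
apply: PD => //; rewrite -mul_mpolyC; apply: (PM _ _ (PC _)).
rewrite mpolyXE_id; elim/big_ind: _ => [|p' q|i _]; [by rewrite -mpolyC1| |].
  exact: PM.
by elim: (m i) => [|k IHk]; rewrite ?expr0 -?mpolyC1 // exprS; apply: PM.
Qed.

Section Composition.
Context (K : comNzRingType).

Lemma comp_mpolyX_tnth n k (i : 'I_n) (lp : n.-tuple {mpoly K[k]}) :
  'X_i \mPo lp = tnth lp i.
Proof. by rewrite comp_mpolyXU -tnth_nth. Qed.

Lemma comp_mpolyM n k (lp : n.-tuple {mpoly K[k]}) (p q : {mpoly K[n]}) :
  (p * q) \mPo lp = (p \mPo lp) * (q \mPo lp).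
Proof. exact: rmorphM. Qed.

Lemma eq_comp_mpoly n k (lp lq : n.-tuple {mpoly K[k]}) (p : {mpoly K[n]}) :
  tnth lp =1 tnth lq -> p \mPo lp = p \mPo lq.
Proof. by move=> e; congr (_ \mPo _); apply: eq_from_tnth. Qed.

Lemma comp_mpolyA n k l (p : {mpoly K[n]}) (lp : n.-tuple {mpoly K[k]})
    (lq : k.-tuple {mpoly K[l]}) :
  (p \mPo lp) \mPo lq = p \mPo [tuple tnth lp i \mPo lq | i < n].
Proof.
elim/mpoly_ring_ind: p => [c|i|p q Ep Eq|p q Ep Eq].
- by rewrite !comp_mpolyC.
- by rewrite !comp_mpolyX_tnth tnth_mktuple.
- by rewrite !comp_mpolyD Ep Eq.
- by rewrite !comp_mpolyM Ep Eq.
Qed.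

Lemma mderiv_comp n k (p : {mpoly K[n]}) (lp : n.-tuple {mpoly K[k]}) j :
  (p \mPo lp)^`M(j) = \sum_(i < n) (p^`M(i) \mPo lp) * (tnth lp i)^`M(j).
Proof.
elim/mpoly_ring_ind: p => [c|i|p q Ep Eq|p q Ep Eq].
- by rewrite comp_mpolyC mderivC big1 // => i _; rewrite mderivC comp_mpoly0 mul0r.
- rewrite comp_mpolyX_tnth (bigD1 i) //= big1 => [|i' ne_i].
    rewrite addr0 mderivX mnm1E eqxx scale1r.
    have -> : (U_(i) - U_(i))%MM = 0%MM by apply/mnmP=> k'; rewrite mnmBE subnn mnm0E.
    by rewrite mpolyX0 comp_mpoly1 mul1r.
  by rewrite mderivX mnm1E eq_sym (negPf ne_i) scale0r comp_mpoly0 mul0r.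
- rewrite comp_mpolyD mderivD Ep Eq -big_split; apply: eq_bigr => i _ /=.
  by rewrite mderivD comp_mpolyD mulrDl.
- rewrite comp_mpolyM mderivM Ep Eq mulr_suml mulr_sumr -big_split.
  apply: eq_bigr => i _ /=; rewrite mderivM comp_mpolyD !comp_mpolyM; ring.
Qed.

Lemma comp_mpoly_homog n k e (u : {mpoly K[k]}) (p : {mpoly K[n]})
    (lp : n.-tuple {mpoly K[k]}) :
  p \is e.-homog -> p \mPo [tuple u * tnth lp i | i < n] = u ^+ e * (p \mPo lp).
Proof.
move/dhomogP=> hp; rewrite !comp_mpolyE mulr_sumr; apply: eq_big_seq => m /hp /= <-.
rewrite -scalerAr mdegE -prodrXr -big_split; congr (_ *: _).
by apply: eq_bigr => i _; rewrite tnth_mktuple exprMn.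
Qed.

Lemma comp_mwiden n k (p : {mpoly K[n]}) (lp : n.+1.-tuple {mpoly K[k]}) :
  mwiden p \mPo lp = p \mPo [tuple tnth lp (widen_ord (leqnSn n) i) | i < n].
Proof.
elim/mpoly_ring_ind: p => [c|i|p q Ep Eq|p q Ep Eq].
- by rewrite mwidenC !comp_mpolyC.
- by rewrite /mwiden mmapX mmap1U !comp_mpolyX_tnth tnth_mktuple.
- by rewrite mwidenD !comp_mpolyD Ep Eq.
- by rewrite mwidenM !comp_mpolyM Ep Eq.
Qed.

End Composition.

(** * From a parametrization to a birational map *)

Section Jacobian.
Context (K : numFieldType).

Lemma mderiv_eq0_const n (p : {mpoly K[n]}) :
  (forall i, p^`M(i) = 0) -> p = (p@_0%MM)%:MP.
Proof.
move=> dp; apply/mpolyP=> m; rewrite mcoeffC; have [->|m0] := eqVneq m 0%MM.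
  by rewrite mulr1.
rewrite mulr0; have [i m_i] : exists i, (0 < m i)%N.
  apply/existsP; apply: contraNT m0 => /existsPn m0; apply/eqP/mnmP=> i.
  by rewrite mnm0E; apply/eqP; rewrite -leqn0 leqNgt.
have := mcoeff_mulX_deriv i p m; rewrite dp mulr0 mcoeff0 => /esym/eqP.
by rewrite mulrn_eq0 eqn0Ngt m_i => /eqP.
Qed.

Lemma msize_mderiv n (p : {mpoly K[n]}) i k :
  (msize p <= k.+1)%N -> (msize p^`M(i) <= k)%N.
Proof.
move=> sp; rewrite msizeE; apply/bigmax_leqP_seq => m; rewrite mcoeff_msupp => + _.
rewrite mcoeff_deriv => m_supp; have : (m + U_(i))%MM \in msupp p.
  by rewrite mcoeff_msupp; apply: contraNneq m_supp => ->; rewrite mul0rn.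
by move/msize_mdeg_lt; rewrite mdegD mdeg1 addn1 => /leq_trans/(_ sp).
Qed.

Definition jacobian (p q : {mpoly K[2]}) : {mpoly K[2]} :=
  p^`M(ord0) * q^`M(ord_max) - p^`M(ord_max) * q^`M(ord0).

(** The Jacobian criterion.  By the chain rule the gradient of a relation r at (p, q) is
in the kernel of an invertible matrix, so the partial derivatives of r are relations
of smaller degree; by induction they vanish, and r is a constant. *)
Lemma jacobian_alg_indep p q (r : {mpoly K[2]}) :
  jacobian p q != 0 -> r \mPo [tuple p; q] = 0 -> r = 0.
Proof.
move=> pq0; have [n] := ubnP (msize r); elim: n r => // -[|n] IHn r.
  by rewrite ltnS leqn0 msize_poly_eq0 => /eqP.
rewrite ltnS => sr rpq.
pose a := r^`M(ord0) \mPo [tuple p; q]; pose b := r^`M(ord_max) \mPo [tuple p; q].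
have chain j : a * p^`M(j) + b * q^`M(j) = 0.
  by have := mderiv_comp r [tuple p; q] j; rewrite rpq mderiv0 sum_ord2.
have a0 : a = 0.
  apply/eqP; rewrite -(mulIr_eq0 _ (mulIf pq0)); apply/eqP; rewrite /jacobian.
  have -> : a * (p^`M(ord0) * q^`M(ord_max) - p^`M(ord_max) * q^`M(ord0)) =
     (a * p^`M(ord0) + b * q^`M(ord0)) * q^`M(ord_max) -
     (a * p^`M(ord_max) + b * q^`M(ord_max)) * q^`M(ord0) by ring.
  by rewrite !chain !mul0r subrr.
have b0 : b = 0.
  apply/eqP; rewrite -(mulIr_eq0 _ (mulIf pq0)); apply/eqP; rewrite /jacobian.
  have -> : b * (p^`M(ord0) * q^`M(ord_max) - p^`M(ord_max) * q^`M(ord0)) =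
     (a * p^`M(ord_max) + b * q^`M(ord_max)) * p^`M(ord0) -
     (a * p^`M(ord0) + b * q^`M(ord0)) * p^`M(ord_max) by ring.
  by rewrite !chain !mul0r subrr.
have rE : r = (r@_0%MM)%:MP.
  apply: mderiv_eq0_const; apply: ord2_ind; apply: IHn => //; rewrite ltnS;
    exact: msize_mderiv.
by move: rpq; rewrite rE comp_mpolyC => /eqP; rewrite mpolyC_eq0 => /eqP ->.
Qed.

(** With E the Euler field, this Jacobian is u (u + E u), and the eigenvalues of 1 + E on
the monomials are positive. *)
Lemma jacobian_scaled_vars (u : {mpoly K[2]}) : u != 0 ->
  jacobian (u * 'X_ord0) (u * 'X_ord_max) != 0.
Proof.
move=> u0; pose e := 'X_ord0 * u^`M(ord0) + 'X_ord_max * u^`M(ord_max).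
have -> : jacobian (u * 'X_ord0) (u * 'X_ord_max) = u * (u + e).
  rewrite /jacobian /e !mderivM !mderivX !mnm1E /= !scale0r !scale1r.
  have subU (i : 'I_2) : (U_(i) - U_(i))%MM = 0%MM.
    by apply/mnmP=> k; rewrite mnmBE subnn mnm0E.
  by rewrite !subU mpolyX0; ring.
rewrite mulf_neq0 //; apply: contraNneq u0 => ue; apply/eqP/mpolyP=> m.
have := congr1 (mcoeff m) ue; rewrite !mcoeffD !mcoeff_mulX_deriv mcoeff0.
rewrite -mulrnDr -mulrS => /eqP; rewrite mulrn_eq0 /=.
by move/eqP.
Qed.

End Jacobian.

(** The Cauchy-Binet formula for a 2 x 3 matrix times a 3 x 2 matrix whose minors
vanish. *)
Lemma minors_product_eq0 (A : comNzRingType) (x0 x1 x2 y0 y1 y2 p0 p1 p2 q0 q1 q2 : A) :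
    p0 * q1 - q0 * p1 = 0 -> p0 * q2 - q0 * p2 = 0 -> p1 * q2 - q1 * p2 = 0 ->
  (x0 * p0 + x1 * p1 + x2 * p2) * (y0 * q0 + y1 * q1 + y2 * q2) -
  (x0 * q0 + x1 * q1 + x2 * q2) * (y0 * p0 + y1 * p1 + y2 * p2) = 0.
Proof.
move=> m01 m02 m12.
transitivity ((x0 * y1 - x1 * y0) * (p0 * q1 - q0 * p1) +
  (x0 * y2 - x2 * y0) * (p0 * q2 - q0 * p2) +
  (x1 * y2 - x2 * y1) * (p1 * q2 - q1 * p2)); first by ring.
by rewrite m01 m02 m12 !mulr0 !addr0.
Qed.

Section Parametrization.
Context (K : numFieldType).
Implicit Types (g P : {mpoly K[3]}) (G : 3.-tuple {mpoly K[2]}) (F : 2.-tuple {mpoly K[3]}).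

(** G maps the projective line to the curve g = 0, and F is a left inverse of G: the
point F(G) is that of coordinates X_0, X_1, up to the common factor u. *)
Definition parametrized_by g G F := exists (d e : nat) u,
  [/\ forall i, tnth G i \is d.-homog,
      forall j, tnth F j \is e.-homog,
      u != 0, g \mPo G = 0 &
      forall j, tnth F j \mPo G = u * 'X_j].

(** By the chain rule, the Jacobian of F(G), which is not 0, is a combination of those of
the pairs of entries of G. *)
Lemma parametrization_jacobian g G F : parametrized_by g G F ->
  exists i j, jacobian (tnth G i) (tnth G j) != 0.
Proof.
case=> a [b [u [_ _ u0 _ FG]]]; apply: NNPP => J0.
have {}J0 i j : jacobian (tnth G i) (tnth G j) = 0.
  by apply/eqP; apply: contraPT J0 => Jij; case; exists i, j.
case/eqP: (jacobian_scaled_vars u0).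
rewrite -!FG /jacobian !mderiv_comp !sum_ord3.
by apply: minors_product_eq0; apply: J0.
Qed.

(** If g does not divide P, the two eliminate to a nonzero polynomial in the first two
variables only, which vanishes at two algebraically independent polynomials. *)
Lemma parametrization_kernel_jac01 g P G : irreducible g ->
  jacobian (tnth G o0) (tnth G o1) != 0 ->
  g \mPo G = 0 -> P \mPo G = 0 -> divides g P.
Proof.
move=> irr J0 gG PG; case: (mpoly_elimination P irr) => // -[r [h [k [r0 rE]]]].
case/eqP: r0; apply: jacobian_alg_indep J0 _.
have := congr1 (comp_mpoly G) rE; rewrite comp_mpolyD !comp_mpolyM gG PG !mulr0 addr0.
rewrite comp_mwiden => <-; apply: eq_comp_mpoly; apply: ord2_ind;
  rewrite tnth_mktuple; congr (tnth G _); exact: val_inj.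
Qed.

Lemma parametrization_kernel g P G F : irreducible g -> parametrized_by g G F ->
  P \mPo G = 0 -> divides g P.
Proof.
move=> irr par PG; have [i [j Jij]] := parametrization_jacobian par.
have [a [b [u [_ _ _ gG _]]]] := par.
(* A permutation brings the independent pair in the first two places. *)
have perm_case (s : 'S_3) : jacobian (tnth G (s o0)) (tnth G (s o1)) != 0 ->
    divides g P.
  move=> Js; pose G' := [tuple tnth G (s i) | i < 3].
  have sK : cancel (msym s^-1%g) (msym s : {mpoly K[3]} -> {mpoly K[3]}).
    by move=> p; rewrite -msymMm mulVg msym1m.
  have sVK : cancel (msym s) (msym s^-1%g : {mpoly K[3]} -> {mpoly K[3]}).
    by move=> p; rewrite -msymMm mulgV msym1m.
  have msymG p : msym s^-1%g p \mPo G' = p \mPo G.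
    rewrite msym_mPo; apply: eq_comp_mpoly => k.
    by rewrite !tnth_mktuple permKV.
  have [||||q] := @parametrization_kernel_jac01 (msym s^-1%g g) (msym s^-1%g P) G'.
  - exact: irreducible_iso sK sVK irr.
  - by rewrite !tnth_mktuple.
  - by rewrite msymG.
  - by rewrite msymG.
  by move/(congr1 (msym s)); rewrite msymM !sK; exists (msym s q).
have ij : i != j.
  by apply: contraNneq Jij => ->; rewrite /jacobian mulrC subrr.
have [s [si sj]] := ex_perm2 (isT : o0 != o1) ij.
by apply: (perm_case s); rewrite si sj.
Qed.

(** Since the polynomials vanishing at G are the multiples of g, each condition modulo g
is checked after substitution of G, where F becomes a multiple of the identity. *)
Lemma parametrized_rational g G F :
  irreducible g -> parametrized_by g G F -> rational_curve g.
Proof.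
move=> irr par; have ker P := parametrization_kernel (P := P) irr par.
have [i [j Jij]] := parametrization_jacobian par.
have [d [e [u [hG hF u0 gG FG]]]] := par.
have Gi0 : tnth G i != 0.
  by apply: contraNneq Jij => ->; rewrite /jacobian !mderiv0 !mul0r subrr.
have ndivides P : P \mPo G != 0 -> ~ divides g P.
  by move=> PG [q PE]; rewrite PE comp_mpolyM gG mulr0 eqxx in PG.
have ndiv0 (q : {mpoly K[2]}) : q != 0 -> ~ divides 0 q.
  by move=> q0 [q' qE]; rewrite qE mulr0 eqxx in q0.
have uX0 k : u * 'X_k != 0 by rewrite mulf_neq0 // -msupp_eq0 msuppX.
have GFG k : (tnth G k \mPo F) \mPo G = u ^+ d * tnth G k.
  rewrite comp_mpolyA (eq_comp_mpoly (lq := [tuple u * tnth [tuple 'X_l | l < 2] l | l < 2])).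
    by rewrite (comp_mpoly_homog _ _ (hG k)) comp_mpoly_id.
  by move=> l; rewrite !tnth_mktuple FG.
exists F, G; split.
- split; first by exists e.
    by exists ord0; apply: ndivides; rewrite FG.
  by exists 0; rewrite comp_mpoly0 mul0r.
- split; first by exists d.
    by exists i; apply: ndiv0.
  by exists 0; rewrite gG mul0r.
- split.
    by exists i; rewrite tnth_mktuple; apply: ndivides; rewrite GFG mulf_neq0 ?expf_neq0.
  move=> k l; apply: ker; rewrite !tnth_mktuple comp_mpolyB !comp_mpolyM !GFG.
  by rewrite !comp_mpolyX_tnth; ring.
- split.
    by exists ord0; rewrite tnth_mktuple FG; apply: ndiv0.
  by move=> k l; exists 0; rewrite !tnth_mktuple !FG; ring.
Qed.

End Parametrization.

(** * Linear vector fields *)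

Section LinearFields.
Context (K : fieldType) (n : nat).
Implicit Types (L M N : 'M[K]_n) (p q g : {mpoly K[n]}).

Definition linear_forms M : n.-tuple {mpoly K[n]} :=
  [tuple \sum_j M i j *: 'X_j | i < n].

(** The derivation whose value on the i-th variable is the i-th row of M, read as a
linear form. *)
Definition linear_field M p : {mpoly K[n]} :=
  \sum_i tnth (linear_forms M) i * p^`M(i).

Lemma linear_forms_homog M i : tnth (linear_forms M) i \is 1.-homog.
Proof.
rewrite tnth_mktuple; apply: rpred_sum => j _; apply: dhomogZ.
by rewrite dhomogX /= mdeg1.
Qed.

Lemma comp_linear_forms k M i (lp : n.-tuple {mpoly K[k]}) :
  tnth (linear_forms M) i \mPo lp = \sum_j M i j *: tnth lp j.
Proof.
rewrite tnth_mktuple raddf_sum; apply: eq_bigr => j _ /=.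
by rewrite comp_mpolyZ comp_mpolyX_tnth.
Qed.

Lemma linear_forms_mul L M i :
  tnth (linear_forms L) i \mPo linear_forms M = tnth (linear_forms (L *m M)) i.
Proof.
rewrite comp_linear_forms tnth_mktuple.
under eq_bigr do rewrite tnth_mktuple scaler_sumr.
rewrite exchange_big; apply: eq_bigr => k _ /=; rewrite mxE scaler_suml.
by apply: eq_bigr => j _; rewrite scalerA.
Qed.

Lemma comp_linear_forms_mul p L M :
  (p \mPo linear_forms L) \mPo linear_forms M = p \mPo linear_forms (L *m M).
Proof.
rewrite comp_mpolyA; apply: eq_comp_mpoly => i.
by rewrite tnth_mktuple linear_forms_mul.
Qed.

Lemma comp_linear_forms1 p : p \mPo linear_forms 1%:M = p.
Proof.
rewrite -[RHS]comp_mpoly_id; apply: eq_comp_mpoly => i; rewrite !tnth_mktuple.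
rewrite (bigD1 i) //= mxE eqxx scale1r big1 ?addr0 // => j ji.
by rewrite mxE eq_sym (negPf ji) scale0r.
Qed.

Lemma irreducible_linear_change L g : L \in unitmx ->
  irreducible g -> irreducible (g \mPo linear_forms L).
Proof.
move=> UL; apply: (@irreducible_iso _ _ (comp_mpoly (linear_forms L))
  (comp_mpoly (linear_forms (invmx L)))) => p /=.
  by rewrite comp_linear_forms_mul mulmxV // comp_linear_forms1.
by rewrite comp_linear_forms_mul mulVmx // comp_linear_forms1.
Qed.

Lemma mcoeff_linear_field M p m :
  (linear_field M p)@_m = \sum_i \sum_j M i j * ('X_j * p^`M(i))@_m.
Proof.
rewrite raddf_sum; apply: eq_bigr => i _ /=; rewrite tnth_mktuple mulr_suml raddf_sum.
by apply: eq_bigr => j _ /=; rewrite -scalerAl mcoeffZ.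
Qed.

Lemma mcoeff_diag_field (d : 'rV[K]_n) p m :
  (linear_field (diag_mx d) p)@_m = (\sum_i d 0 i * (m i)%:R) * p@_m.
Proof.
rewrite mcoeff_linear_field mulr_suml; apply: eq_bigr => i _.
rewrite (bigD1 i) //= big1 => [|j ji].
  by rewrite addr0 mxE eqxx mulr1n mcoeff_mulX_deriv -[p@_m *+ _]mulr_natr mulrAC mulrA.
by rewrite mxE eq_sym (negPf ji) mulr0n mul0r.
Qed.

(** The linear substitution with matrix L intertwines the fields of two matrices that it
conjugates. *)
Lemma linear_field_change L M N p : L *m N = M *m L ->
  linear_field N (p \mPo linear_forms L) = linear_field M p \mPo linear_forms L.
Proof.
move=> LN; rewrite /linear_field raddf_sum /=.
under eq_bigr do rewrite mderiv_comp mulr_sumr.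
rewrite exchange_big; apply: eq_bigr => i _ /=.
rewrite comp_mpolyM linear_forms_mul -LN -linear_forms_mul comp_linear_forms.
rewrite mulrC mulr_sumr; apply: eq_bigr => j _.
have -> : (tnth (linear_forms L) i)^`M(j) = (L i j)%:MP.
  rewrite tnth_mktuple raddf_sum /= (bigD1 j) //= big1 => [|k kj].
    rewrite addr0 mderivZ mderivX mnm1E eqxx scale1r.
    have -> : (U_(j) - U_(j))%MM = 0%MM by apply/mnmP=> k; rewrite mnmBE subnn mnm0E.
    by rewrite mpolyX0 -mul_mpolyC mulr1.
  by rewrite mderivZ mderivX mnm1E (negPf kj) scale0r scaler0.
by rewrite -mul_mpolyC; ring.
Qed.

Lemma linear_fieldM M p q :
  linear_field M (p * q) = linear_field M p * q + p * linear_field M q.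
Proof.
rewrite /linear_field mulr_suml mulr_sumr -big_split; apply: eq_bigr => i _ /=.
by rewrite mderivM; ring.
Qed.

Lemma mcoeff_mulX_mderiv i j p m : ('X_j * p^`M(i))@_m =
  if (0 < m j)%N then p@_(m - U_(j) + U_(i)) *+ ((m - U_(j))%MM i).+1 else 0.
Proof. by rewrite mcoeff_mulX; case: ifP => // _; rewrite mcoeff_deriv. Qed.

Lemma msize_linear_field M p : (msize (linear_field M p) <= msize p)%N.
Proof.
rewrite [leqLHS]msizeE; apply/bigmax_leqP_seq => m; rewrite mcoeff_msupp => + _.
apply: contraR; rewrite -leqNgt => sm; rewrite /linear_field raddf_sum /=.
rewrite big1 // => i _; rewrite tnth_mktuple mulr_suml raddf_sum big1 //= => j _.
rewrite -scalerAl mcoeffZ mcoeff_mulX_mderiv; case: ifP => [mj|_]; last by rewrite mulr0.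
have : (m - U_(j) + U_(i))%MM \notin msupp p.
  apply: msize_mdeg_ge; rewrite mdegD mdeg1 -(mdeg1 j) -mdegD submK //.
  by rewrite mnm1_le.
by move/memN_msupp_eq0=> ->; rewrite mul0rn mulr0.
Qed.

(** From f = q g and the Leibniz rule, g divides q times its own derivative.  It does
not divide q because f is squarefree, so it divides its derivative, which has at most
the degree of g. *)
Lemma linear_field_eigen M f g : squarefree f -> irreducible g -> divides g f ->
  linear_field M f = 0 -> exists c, linear_field M g = c *: g.
Proof.
move=> sqf irr [q fE] Mf; have [g0 gU _] := irr.
have [_ _ gprime] := factorial_irreducible_prime (@factorial_mpoly K n) irr.
have : divides g (q * linear_field M g).
  exists (- linear_field M q).
  by apply/eqP; rewrite mulNr -addr_eq0 addrC -linear_fieldM -fE Mf.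
case/gprime=> [[r qE]|[r rE]].
  case/negP: gU; apply: sqf; exists r; by rewrite fE qE expr2 mulrA.
suff : (msize r <= 1)%N by move/msize1_polyC=> rC; exists r@_0%MM; rewrite rE {1}rC mul_mpolyC.
have [->|r0] := eqVneq r 0; first by rewrite msize0.
have := msize_linear_field M g; rewrite rE msizeM // -subn1 leq_subLR.
by rewrite leq_add2r.
Qed.

End LinearFields.

(** Euler's formula: the field of the scalar matrix a multiplies f by a d. *)
Lemma scalar_field_killing (K : numClosedFieldType) d (a : K) (f : {mpoly K[3]}) :
  f \is d.-homog -> f != 0 -> (0 < d)%N -> linear_field a%:M f = 0 -> a = 0.
Proof.
move=> hf f0 d0 af; have fm : f@_(mlead f) != 0 by rewrite mleadc_eq0.
have := congr1 (mcoeff (mlead f)) af; rewrite -diag_const_mx mcoeff_diag_field mcoeff0.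
under eq_bigr do rewrite mxE.
rewrite -mulr_sumr -natr_sum -mdegE (homog_coeff_neq0 hf fm) => /eqP.
by rewrite !mulf_eq0 (negPf fm) orbF pnatr_eq0 eqn0Ngt d0 orbF => /eqP.
Qed.

(** * Transfer of parametrizations *)

Section ParametrizationTransfer.
Context (K : numFieldType).
Implicit Types (g : {mpoly K[3]}) (G : 3.-tuple {mpoly K[2]}) (F : 2.-tuple {mpoly K[3]}).

Definition parametrized g := exists G F, parametrized_by g G F.

Lemma comp_homog n k d e (p : {mpoly K[n]}) (lp : n.-tuple {mpoly K[k]}) :
  p \is d.-homog -> (forall i, tnth lp i \is e.-homog) -> p \mPo lp \is (e * d)%N.-homog.
Proof.
move=> hp hlp; rewrite comp_mpolyE big_seq; apply: rpred_sum => m m_p.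
apply: dhomogZ; have /= <- := dhomogP _ _ _ hp m m_p; rewrite mdegE big_distrr /=.
elim/big_rec2: _ => [|i d' q _ hq]; first exact: dhomog1.
by apply: dhomogM => //; apply: dhomogMn.
Qed.

Lemma parametrized_linear_change g L : L \in unitmx ->
  parametrized (g \mPo linear_forms L) -> parametrized g.
Proof.
move=> UL [G [F [d [e [u [hG hF u0 gG FG]]]]]].
pose G' := [tuple tnth (linear_forms L) i \mPo G | i < 3].
pose F' := [tuple tnth F i \mPo linear_forms (invmx L) | i < 2].
exists G', F', d, e, u; split=> //.
- move=> i; rewrite tnth_mktuple -[d]muln1.
  exact: comp_homog (linear_forms_homog L i) hG.
- move=> i; rewrite tnth_mktuple -[e]mul1n.
  exact: comp_homog (hF i) (linear_forms_homog (invmx L)).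
- by rewrite -gG comp_mpolyA.
- move=> j; rewrite tnth_mktuple -FG -[in RHS](comp_linear_forms1 (tnth F j)).
  by rewrite -(mulVmx UL) -comp_linear_forms_mul [in RHS]comp_mpolyA.
Qed.

Lemma parametrized_msym g (s : 'S_3) : parametrized (msym s g) -> parametrized g.
Proof.
move=> [G [F [d [e [u [hG hF u0 gG FG]]]]]].
exists [tuple tnth G (s i) | i < 3], [tuple msym s^-1%g (tnth F i) | i < 2], d, e, u.
split=> //.
- by move=> i; rewrite tnth_mktuple.
- move=> i; rewrite tnth_mktuple; apply/dhomogP => m.
  rewrite mcoeff_msupp mcoeff_sym -mcoeff_msupp => /(dhomogP _ _ _ (hF i)) /= <-.
  by rewrite mdeg_mperm.
- by rewrite -msym_mPo.
- move=> j; rewrite tnth_mktuple -FG msym_mPo; apply: eq_comp_mpoly => i.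
  by rewrite !tnth_mktuple permKV.
Qed.

(** The curve contains the line X_i = 0, which the other two variables parametrize. *)
Lemma parametrized_coordinate_line g (i : 'I_3) :
  (forall m, g@_m != 0 -> (0 < m i)%N) -> parametrized g.
Proof.
move=> supp_i; apply: (@parametrized_msym _ (tperm i ord0)).
have {}supp_i m : (msym (tperm i ord0) g)@_m != 0 -> (0 < m ord0)%N.
  by rewrite mcoeff_sym => /supp_i; rewrite mnmE tpermL.
move: (msym _ g) supp_i => h supp0.
exists [tuple 0; 'X_ord0; 'X_ord_max], [tuple 'X_o1; 'X_o2], 1%N, 1%N, 1; split.
- apply: ord3_ind; rewrite /tnth /=; [exact: dhomog0| |]; by rewrite dhomogX /= mdeg1.
- by apply: ord2_ind; rewrite /tnth /= dhomogX /= mdeg1.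
- exact: oner_neq0.
- rewrite comp_mpolyE big_seq big1 // => m; rewrite mcoeff_msupp => /supp0 m0.
  by rewrite big_ord_recl /= expr0n eqn0Ngt m0 mul0r scaler0.
- by apply: ord2_ind; rewrite mul1r /tnth /= comp_mpolyX_tnth.
Qed.

End ParametrizationTransfer.

(** * Normal forms of a three by three matrix *)

Section NormalForm.
Context (K : closedFieldType).
Implicit Types (M L : 'M[K]_3) (u v w : 'rV[K]_3).

(** Isolates a double root of the minimal polynomial. *)
Lemma nonuniq_perm (T : eqType) (s : seq T) :
  ~~ uniq s -> exists a s', perm_eq s [:: a, a & s'].
Proof.
elim: s => //= x s IHs; rewrite negb_and negbK => /orP[xs|/IHs[a [s' ps]]].
  by exists x, (rem x s); rewrite perm_cons perm_to_rem.
exists a, (x :: s'); apply: perm_trans (_ : perm_eq _ [:: x, a, a & s']) _.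
  by rewrite perm_cons.
by rewrite (perm_catCA [:: x] [:: a; a]).
Qed.

(** The minimal polynomial has a double root a.  Evaluated at M, its quotient by X - a is
not 0, but becomes 0 when multiplied by M - a; so a nonzero row of this matrix is an
eigenvector, and it is the image by M - a of a row of the quotient by (X - a)^2. *)
Lemma nondiagonalizable_chain n (M : 'M[K]_n.+1) : ~ diagonalizable M ->
  exists a (u v : 'rV[K]_n.+1),
   [/\ u != 0, u *m M = a *: u & v *m M = a *: v + u].
Proof.
move=> ndiag; have [rs rsE] := closed_field_poly_normal (mxminpoly M).
rewrite (monicP (mxminpoly_monic M)) scale1r in rsE.
have /nonuniq_perm[a [rs' prs]] : ~~ uniq rs.
  by apply/negP=> urs; apply: ndiag; apply/diagonalizableP; exists rs; rewrite // rsE.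
pose q := \prod_(z <- rs') ('X - z%:P).
have qE : mxminpoly M = q * ('X - a%:P) * ('X - a%:P).
  by rewrite rsE (perm_big _ prs) !big_cons /= mulrA mulrC mulrA.
have XaE : horner_mx M ('X - a%:P) = M - a%:M.
  by rewrite rmorphB /= horner_mx_X horner_mx_C.
pose B := horner_mx M q.
have BM0 : B *m (M - a%:M) *m (M - a%:M) = 0.
  by have := mx_root_minpoly M; rewrite qE !rmorphM /= XaE.
have Bnz : B *m (M - a%:M) != 0.
  apply/eqP=> B0; have : horner_mx M (q * ('X - a%:P)) = 0 by rewrite rmorphM /= XaE.
  (* A polynomial that kills M has at least the degree of the minimal polynomial. *)
  have qX0 : q * ('X - a%:P) != 0.
    by rewrite monic_neq0 // monicMl ?monicXsubC // monic_prod_XsubC.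
  move/mxminpoly_min/(dvdp_leq qX0); rewrite qE size_Mmonic ?monicXsubC //.
  by rewrite size_XsubC addn2 /= ltnn.
have /rowV0Pn[u /submxP[x uE] u0] := Bnz.
exists a, u, (x *m B); split=> //.
  apply/eqP; rewrite -subr_eq0 -mul_mx_scalar -mulmxBr uE -mulmxA BM0 mulmx0.
  by [].
by rewrite addrC uE mulmxA mulmxBr mul_mx_scalar subrK.
Qed.

Definition frame u v w : 'M[K]_3 := \matrix_(i < 3) nth 0 [:: u; v; w] i.

Lemma mul_frame x u v w :
  x *m frame u v w = x 0 o0 *: u + x 0 o1 *: v + x 0 o2 *: w.
Proof. by rewrite mulmx_sum_row sum_ord3 !rowK. Qed.

(** Applying M - a to a relation between u and v leaves a multiple of u, so u and v are
independent. *)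
Lemma chain_frame_unit M a u v w :
    u != 0 -> u *m M = a *: u -> v *m M = a *: v + u ->
  (forall s t, w != s *: u + t *: v) -> frame u v w \in unitmx.
Proof.
move=> u0 uM vM wuv; rewrite -row_free_unit; apply: inj_row_free => x.
rewrite mul_frame; set x0 := x 0 o0; set x1 := x 0 o1; set x2 := x 0 o2 => x_uvw.
have x2_0 : x2 = 0.
  apply/eqP; apply: contraT => x2_0; case/eqP: (wuv (- (x2^-1 * x0)) (- (x2^-1 * x1))).
  apply/rowP=> j; have /rowP/(_ j) := x_uvw; rewrite !mxE => E.
  apply: (mulfI x2_0); transitivity (- (x0 * u 0 j + x1 * v 0 j)).
    by apply/eqP; rewrite -addr_eq0 addrC E.
  by field.
have x_uv : x0 *: u + x1 *: v = 0 by rewrite -x_uvw x2_0 scale0r addr0.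
have x1_0 : x1 = 0.
  have := congr1 (mulmx^~ M) x_uv; rewrite mulmxDl -!scalemxAl uM vM mul0mx.
  rewrite scalerDr addrA !scalerA ![_ * a]mulrC -!scalerA -scalerDr x_uv scaler0 add0r.
  by move/eqP; rewrite scaler_eq0 (negPf u0) orbF => /eqP.
have x0_0 : x0 = 0.
  by move/eqP: x_uv; rewrite x1_0 scale0r addr0 scaler_eq0 (negPf u0) orbF => /eqP.
by apply/rowP; apply: ord3_ind; rewrite mxE.
Qed.

Lemma ex_independent u v : exists w, forall s t, w != s *: u + t *: v.
Proof.
have [i wi] : exists i, ~~ (row i (1%:M : 'M[K]_3) <= col_mx u v)%MS.
  apply/existsP; rewrite -negb_forall; apply/negP=> /forallP/row_subP/mxrankS.
  by rewrite mxrank1 => le3; have := leq_trans le3 (rank_leq_row _).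
exists (row i 1%:M) => s t; apply: contraNneq wi => ->.
have /andP[uS vS] : ((u <= col_mx u v)%MS && (v <= col_mx u v)%MS).
  by rewrite -col_mx_sub.
by rewrite addmx_sub // scalemx_sub.
Qed.

(** The scalar matrix a plus the nilpotent field X_0 d_1 + c X_1 d_2 plus b X_2 d_2.  The
entries c and b are not both nonzero in the normal form, so these parts commute. *)
Definition jordan_mx (a c b : K) : 'M[K]_3 :=
  \matrix_(i < 3, j < 3) nth 0 (nth [::] [:: [:: a]; [:: 1; a]; [:: 0; c; a + b]] i) j.

(** A Jordan chain u, v is completed by any independent w, whose image under M - a is
e u + c v + b w.  If b = 0, subtracting e v from w removes the term e u; otherwise
adding a combination of u and v to w removes both e u and c v. *)
Lemma linear_normal_form M :
  (exists L d, L \in unitmx /\ L *m M = diag_mx d *m L) \/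
  (exists L a c b, [/\ L \in unitmx, c * b = 0 & L *m M = jordan_mx a c b *m L]).
Proof.
have [|/nondiagonalizable_chain[a [u [v [u0 uM vM]]]]] := classic (diagonalizable M).
  by case=> L UL /diagonalizable_forPex[d /(simmxP UL) LM]; left; exists L, d.
right; have [w wuv] := ex_independent u v.
have unit_w := chain_frame_unit u0 uM vM.
have normal w' c b : c * b = 0 -> w' *m M = c *: v + (a + b) *: w' ->
    (forall s t, w' != s *: u + t *: v) ->
    exists L a c b, [/\ L \in unitmx, c * b = 0 & L *m M = jordan_mx a c b *m L].
  move=> cb wM w'uv; exists (frame u v w'), a, c, b; split=> //; first exact: unit_w.
  apply/row_matrixP; apply: ord3_ind; rewrite !row_mul mul_frame !mxE /= rowK /=.
  - by rewrite uM !scale0r !addr0.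
  - by rewrite vM scale1r scale0r addr0 addrC.
  - by rewrite wM scale0r add0r.
pose x := (w *m M - a *: w) *m invmx (frame u v w).
have wM : w *m M = a *: w + (x 0 o0 *: u + x 0 o1 *: v + x 0 o2 *: w).
  by rewrite -mul_frame mulmxKV ?unit_w // addrC subrK.
move: (x 0 o0) (x 0 o1) (x 0 o2) wM => e c b wM.
have indep s t : forall s' t', w + (s *: u + t *: v) != s' *: u + t' *: v.
  move=> s' t'; apply: contra_neq (wuv (s' - s) (t' - t)) => /(canRL (addrK _)) ->.
  by rewrite !scalerBl opprD addrACA.
have [b0|b0] := eqVneq b 0.
  apply: (normal (w + (0 *: u + (- e) *: v)) c 0); rewrite ?mulr0 //.
  rewrite !mulmxDl -!scalemxAl wM uM vM b0.
  by apply/rowP=> j; rewrite !mxE; ring.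
(* The image of w + t u + s v under M - a must be b times this vector. *)
pose s := c / b; pose t := (e + s) / b.
apply: (normal (w + (t *: u + s *: v)) 0 b); rewrite ?mul0r //.
rewrite !mulmxDl -!scalemxAl wM uM vM /t /s.
by apply/rowP=> j; rewrite !mxE; field.
Qed.

End NormalForm.

(** * Restriction to a curve *)

Section Restriction.
Context (K : fieldType) (n : nat).
Implicit Types (g : {mpoly K[n]}) (h : 'I_n -> {poly K}) (v : 'I_n -> K).

(** The restriction of g to the curve with the polynomial parametrization h. *)
Definition restrict h g : {poly K} := mmap (@polyC K) h g.

Lemma horner_restrict h g t : (restrict h g).[t] = g.@[fun i => (h i).[t]].
Proof.
elim/mpoly_ring_ind: g => [c|i|p q Ep Eq|p q Ep Eq]; rewrite /restrict.
- by rewrite mmapC hornerC mevalC.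
- by rewrite mmapX mmap1U mevalXU.
- by rewrite mmapD hornerD mevalD -Ep -Eq.
- by rewrite rmorphM hornerM mevalM -Ep -Eq.
Qed.

Lemma coef_restrict_unique h g k m0 :
  (forall m, g@_m != 0 -> m != m0 -> (\prod_i h i ^+ m i)`_k = 0) ->
  (restrict h g)`_k = g@_m0 * (\prod_i h i ^+ m0 i)`_k.
Proof.
move=> uniq_m0; rewrite /restrict /mmap coef_sum.
have [m0g|m0g] := boolP (m0 \in msupp g); last first.
  rewrite (memN_msupp_eq0 m0g) mul0r big_seq big1 // => m mg.
  rewrite coefCM uniq_m0 ?mulr0 -?mcoeff_msupp //.
  by apply: contraNneq m0g => <-.
rewrite (bigD1_seq m0) ?msupp_uniq //= coefCM big_seq_cond big1 ?addr0 //.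
by move=> m /andP[mg mm0]; rewrite coefCM uniq_m0 ?mulr0 -?mcoeff_msupp.
Qed.

Lemma comp_mpoly_const k g v :
  g \mPo [tuple (v i)%:MP_[k] | i < n] = (g.@[v])%:MP.
Proof.
elim/mpoly_ring_ind: g => [c|i|p q Ep Eq|p q Ep Eq].
- by rewrite comp_mpolyC mevalC.
- by rewrite comp_mpolyX_tnth tnth_mktuple mevalXU.
- by rewrite comp_mpolyD mevalD mpolyCD Ep Eq.
- by rewrite comp_mpolyM mevalM mpolyCM Ep Eq.
Qed.

End Restriction.

Lemma comp_mderiv_max_eq0 (K : numFieldType) (p : {mpoly K[2]}) :
  p^`M(ord_max) = 0 -> p \mPo [tuple 'X_ord0; 0] = p.
Proof.
move=> dp; rewrite [RHS]mpolyE comp_mpolyEX; apply: eq_big_seq => m.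
rewrite mcoeff_msupp => pm; congr (_ *: _).
have m1 : m ord_max = 0%N.
  have := mcoeff_mulX_deriv ord_max p m; rewrite dp mulr0 mcoeff0 => /esym/eqP.
  by rewrite mulrn_eq0 (negPf pm) orbF => /eqP.
by rewrite comp_mpolyX [RHS]mpolyXE_id !prod_ord2 m1 !expr0.
Qed.

(** * Curves invariant under a unipotent group *)

Section UnipotentCase.
Context (K : numClosedFieldType).
Implicit Types (g : {mpoly K[3]}).

Lemma mcoeff_jordan_field a c b g m :
  (linear_field (jordan_mx a c b) g)@_m =
    ('X_o0 * g^`M(o1))@_m + c * ('X_o1 * g^`M(o2))@_m +
    (a * (mdeg m)%:R + b * (m o2)%:R) * g@_m.
Proof.
rewrite mcoeff_linear_field !sum_ord3 !mxE /= !mcoeff_mulX_deriv mdegE sum_ord3.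
by rewrite !natrD -!(mulr_natr g@_m); ring.
Qed.

(** The coefficients of the nilpotent part at m are (nu - b m_2) times those of g, and
the nilpotent part moves coefficients along the weight m_1 + 2 m_2 by one step.  As
this weight is bounded by twice the degree, downward induction on it shows that
(nu - b m_2) g_m = 0; the factor is unchanged along a step because c b = 0. *)
Lemma jordan_eigen_nilpotent e a c b l g : g \is e.-homog -> c * b = 0 ->
  linear_field (jordan_mx a c b) g = l *: g -> linear_field (jordan_mx 0 c 0) g = 0.
Proof.
move=> hg cb eig; pose nu := l - a * e%:R.
have coefE m : ('X_o0 * g^`M(o1))@_m + c * ('X_o1 * g^`M(o2))@_m =
               (nu - b * (m o2)%:R) * g@_m.
  have := congr1 (mcoeff m) eig; rewrite mcoeff_jordan_field mcoeffZ /nu.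
  have [-> |gm] := eqVneq g@_m 0; first by rewrite !mulr0 addr0.
  rewrite (homog_coeff_neq0 hg gm) => /(canRL (addrK _)) ->; ring.
suff nu0 (m : 'X_{1..3}) : (nu - b * (m o2)%:R) * g@_m = 0.
  apply/mpolyP=> m; rewrite mcoeff_jordan_field coefE nu0 mcoeff0; ring.
have [k] : exists k, (2 * e < m o1 + 2 * m o2 + k)%N by exists (2 * e).+1; lia.
elim: k m => [|k IHk] m mk.
  have [-> |gm] := eqVneq g@_m 0; first by rewrite mulr0.
  by have := homog_coeff_neq0 hg gm; rewrite mdeg3; lia.
(* One factor turns g_m into the coefficients at two neighbours of m, the other kills these. *)
suff : (nu - b * (m o2)%:R) ^+ 2 * g@_m = 0.
  by move/eqP; rewrite mulf_eq0 expf_eq0 /= -mulf_eq0 => /eqP.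
rewrite expr2 -mulrA -coefE.
have x1_0 : (nu - b * (m o2)%:R) * ('X_o0 * g^`M(o1))@_m = 0.
  rewrite mcoeff_mulX_mderiv; case: ifP => [m0|_]; last by rewrite mulr0.
  set m' := (m - U_(o0) + U_(o1))%MM.
  have m'1 : m' o1 = (m o1).+1 by rewrite mnmDE mnmBE !mnm1E /= subn0 addn1.
  have m'2 : m' o2 = m o2 by rewrite mnmDE mnmBE !mnm1E /= subn0 addn0.
  by rewrite [LHS]mulrnAr -m'2 IHk ?mul0rn // m'1 m'2; lia.
have x2_0 : c * (nu - b * (m o2)%:R) * ('X_o1 * g^`M(o2))@_m = 0.
  rewrite mcoeff_mulX_mderiv; case: ifP => [m1|_]; last by rewrite mulr0.
  set m' := (m - U_(o1) + U_(o2))%MM.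
  have m'1 : m' o1 = (m o1).-1 by rewrite mnmDE mnmBE !mnm1E /= addn0 subn1.
  have m'2 : m' o2 = (m o2).+1 by rewrite mnmDE mnmBE !mnm1E /= subn0 addn1.
  have IHm' : (nu - b * (m' o2)%:R) * g@_m' = 0.
    by apply: IHk; rewrite m'1 m'2; lia.
  have -> : c * (nu - b * (m o2)%:R) = c * (nu - b * (m' o2)%:R).
    by rewrite !mulrBr !mulrA cb !mul0r.
  by rewrite [LHS]mulrnAr -mulrA IHm' mulr0 mul0rn.
by rewrite mulrDr x1_0 add0r mulrCA mulrA x2_0.
Qed.

(** Such a g is determined by its coefficients at the exponents with m_1 = 0: the
vanishing of the image of g is a recursion which expresses a coefficient through one
whose exponent m_1 is smaller by 2, and gives 0 when m_1 = 1. *)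
Lemma nilpotent_support c g :
    linear_field (jordan_mx 0 c 0) g = 0 ->
    (forall m : 'X_{1..3}, m o1 = 0%N -> g@_m != 0 -> m o2 = 0%N) ->
  forall m : 'X_{1..3}, g@_m != 0 -> m o1 = 0%N /\ m o2 = 0%N.
Proof.
move=> Ng supp0.
suff claim k (m : 'X_{1..3}) : (m o1 < k)%N -> (0 < m o1 + m o2)%N -> g@_m = 0.
  move=> m gm; have := claim (m o1).+1 m (ltnSn _).
  by case: (m o1 + m o2)%N (addn_eq0 (m o1) (m o2)) => [/esym/andP[/eqP-> /eqP->]|k _ /(_ isT)] //;
    move=> g0; rewrite g0 eqxx in gm.
elim/ltn_ind: k m => k IHk m mk m_pos.
case m1E : (m o1) => [|j].
  apply/eqP; apply: contraT => gm; have := supp0 m m1E gm.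
  by move: m_pos; rewrite m1E; lia.
(* The recursion is the coefficient at m' of the vanishing image of g. *)
set m' := (m - U_(o1) + U_(o0))%MM.
have := congr1 (mcoeff m') Ng; rewrite mcoeff_jordan_field mcoeff0 !mul0r !addr0 mul0r addr0.
rewrite !mcoeff_mulX_mderiv.
have -> : (0 < m' o0)%N by rewrite mnmDE mnm1E addn1.
have -> : (m' - U_(o0) + U_(o1))%MM = m.
  apply/mnmP; apply: ord3_ind; rewrite !(mnmDE, mnmBE, mnm1E) /= ?m1E; lia.
have -> : (if (0 < m' o1)%N then g@_(m' - U_(o1) + U_(o2)) *+ ((m' - U_(o1))%MM o2).+1 else 0) = 0.
  case: ifP => // m'1; rewrite (IHk j) ?mul0rn //; first lia.
    by rewrite !(mnmDE, mnmBE, mnm1E) /= m1E; move: m'1; rewrite !(mnmDE, mnmBE, mnm1E) /= m1E; lia.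
  by rewrite !(mnmDE, mnmBE, mnm1E) /=; lia.
by rewrite mulr0 addr0 => /eqP; rewrite mulrn_eq0 /= => /eqP.
Qed.

End UnipotentCase.

Section Unipotent.
Context (K : numClosedFieldType).
Implicit Types (g : {mpoly K[3]}).

(** The orbit of (1 : 0 : t) under the one-parameter group of the field is a line or a
conic, parametrized by G.  It lies on the curve as soon as (1 : 0 : t) does, and such
a t exists unless g is a power of X_0 up to a constant. *)
Lemma parametrized_nilpotent e c g : g \is e.-homog ->
  linear_field (jordan_mx 0 c 0) g = 0 -> g != 0 -> g \isn't a GRing.unit ->
  parametrized g.
Proof.
move=> hg Ng g0 gU.
have [[mk [mk1 gmk mk2]]|nomk] :=
    classic (exists m : 'X_{1..3}, [/\ m o1 = 0%N, g@_m != 0 & (0 < m o2)%N]); last first.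
  apply: (@parametrized_coordinate_line _ _ o0) => m gm.
  have [m1 m2] : m o1 = 0%N /\ m o2 = 0%N.
    apply: nilpotent_support Ng _ _ gm => m' m'1 gm'.
    by apply/eqP; rewrite -leqn0 leqNgt; apply/negP => m'2; case: nomk; exists m'.
  rewrite lt0n; apply: contraNneq gU => m0; apply: homog0_unit => //.
  have e0 : e = 0%N by rewrite -(homog_coeff_neq0 hg gm) mdeg3 m0 m1 m2.
  by move: hg; rewrite e0.
(* The points (1 : 0 : t) form a line transverse to the orbits. *)
pose h := tnth [tuple 1; 0; 'X : {poly K}].
have hprod (m : 'X_{1..3}) : \prod_i h i ^+ m i = (0 ^+ m o1) *: 'X^(m o2).
  by rewrite prod_ord3 /h /tnth /= expr1n mul1r -mul_polyC rmorphXn /= polyC0.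
have [t /rootP] : exists t, root (restrict h g) t.
  apply/closed_rootP/negP=> /eqP sz.
  have : (restrict h g)`_(mk o2) = 0 by rewrite nth_default // sz.
  rewrite (coef_restrict_unique (m0 := mk)) => [|m gm].
    rewrite hprod mk1 expr0 scale1r coefXn eqxx mulr1 => /eqP.
    by rewrite (negPf gmk).
  apply: contraNeq; rewrite hprod coefZ coefXn expr0n => neq0.
  have m1 : m o1 = mk o1.
    by rewrite mk1; apply/eqP; move: neq0; case: (m o1 == 0)%N; rewrite ?mul0r ?eqxx.
  have m2 : m o2 = mk o2.
    apply/eqP; rewrite eq_sym; move: neq0.
    by case: (mk o2 == m o2); rewrite ?mulr0 ?eqxx.
  apply/eqP/mnmP; apply: ord3_ind => //.
  have := homog_coeff_neq0 hg gm; rewrite -(homog_coeff_neq0 hg gmk) !mdeg3; lia.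
rewrite horner_restrict => gt0.
pose x : {mpoly K[2]} := 'X_ord0; pose y : {mpoly K[2]} := 'X_ord_max.
pose G := [tuple x * x; x * y; t *: (x * x) + (c / 2%:R) *: (y * y)].
have x0 : x != 0 by rewrite -msupp_eq0 msuppX.
have hXX (i j : 'I_2) : ('X_i * 'X_j : {mpoly K[2]}) \is 2.-homog.
  by apply: (@dhomogM _ _ _ 1 _ 1); rewrite dhomogX /= mdeg1.
have dX (i j : 'I_2) : ('X_i : {mpoly K[2]})^`M(j) = (i == j)%:R.
  rewrite mderivX mnm1E; case: eqP => [->|_]; last by rewrite scale0r.
  have -> : (U_(j) - U_(j))%MM = 0%MM by apply/mnmP=> k'; rewrite mnmBE subnn mnm0E.
  by rewrite mpolyX0 scale1r.
have dG0 : (x * x)^`M(ord_max) = 0 by rewrite mderivM !dX mulr0 mul0r addr0.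
have dG1 : (x * y)^`M(ord_max) = x by rewrite mderivM !dX mul0r mulr1 add0r.
have dG2 : (t *: (x * x) + (c / 2%:R) *: (y * y))^`M(ord_max) = c *: y.
  rewrite mderivD !mderivZ dG0 scaler0 add0r mderivM !dX mul1r mulr1 -mulr2n.
  by rewrite -scaler_nat scalerA divfK ?pnatr_eq0.
(* The curve G is tangent to the field, which kills g, so g(G) does not depend on y. *)
have dgG : (g \mPo G)^`M(ord_max) = 0.
  have := congr1 (comp_mpoly G) Ng; rewrite comp_mpoly0 /linear_field raddf_sum /=.
  rewrite sum_ord3 !comp_mpolyM !comp_linear_forms !sum_ord3 !mxE /= mderiv_comp sum_ord3.
  rewrite ![tnth G _]/tnth /= dG0 dG1 dG2 !scale0r scale1r.
  rewrite !(add0r, addr0, mul0r, mulr0) => Ng'; apply: (mulfI x0).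
  rewrite mulr0 -Ng' -!mul_mpolyC.
  by move: (g^`M(o1) \mPo G) (g^`M(o2) \mPo G) => g_1 g_2; ring.
(* It can thus be computed at y = 0, where it is a multiple of g(1, 0, t). *)
have gG : g \mPo G = 0.
  rewrite -(comp_mderiv_max_eq0 dgG) comp_mpolyA.
  pose v i := (h i).[t].
  have := comp_mpoly_homog (x * x) [tuple (v i)%:MP_[2] | i < 3] hg.
  rewrite comp_mpoly_const gt0 mpolyC0 mulr0 => E; rewrite -[RHS]E.
  apply: eq_comp_mpoly; apply: ord3_ind; rewrite !tnth_mktuple /v /tnth /= hornerE.
  - by rewrite comp_mpolyM comp_mpolyX_tnth mpolyC1 mulr1.
  - by rewrite comp_mpolyM !comp_mpolyX_tnth mpolyC0 !mulr0.
  - rewrite comp_mpolyD !comp_mpolyZ !comp_mpolyM !comp_mpolyX_tnth.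
    by rewrite /tnth /= !mulr0 scaler0 addr0 -mul_mpolyC mulrC.
exists G, [tuple 'X_o0; 'X_o1], 2%N, 1%N, x; split=> //.
- apply: ord3_ind; rewrite /tnth /=; try exact: hXX.
  by apply: rpredD; apply: dhomogZ; apply: hXX.
- by apply: ord2_ind; rewrite /tnth /= dhomogX /= mdeg1.
- by apply: ord2_ind; rewrite /tnth /= comp_mpolyX_tnth.
Qed.

End Unipotent.

(** * Curves invariant under a torus *)

Lemma ex_nonzero_root0 (K : closedFieldType) (p : {poly K}) j :
  p`_0 != 0 -> p`_j.+1 != 0 -> exists2 t, t != 0 & root p t.
Proof.
move=> p0 pj; have [t pt] : exists t, root p t.
  by apply/closed_rootP/negP=> /eqP sp; move: pj; rewrite nth_default ?eqxx // sp.
by exists t => //; apply: contraTneq pt => ->; rewrite /root horner_coef0.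
Qed.

(** Dividing by a power of the variable reduces to a nonzero constant coefficient. *)
Lemma ex_nonzero_root (K : closedFieldType) (p : {poly K}) i j :
  (i < j)%N -> p`_i != 0 -> p`_j != 0 -> exists2 t, t != 0 & root p t.
Proof.
elim: i j p => [|i IHi] [|j] p // ij pi pj; first exact: ex_nonzero_root0 pi pj.
have [p0|p0] := eqVneq p`_0 0; last exact: ex_nonzero_root0 p0 pj.
pose q : {poly K} := \poly_(k < size p) p`_k.+1.
have qE k : q`_k = p`_k.+1.
  by rewrite coef_poly; case: ltnP => // sp; rewrite nth_default // ltnW.
have pE : p = q * 'X by apply/polyP=> -[|k]; rewrite coefMX ?p0 //= qE.
have [||t t0 qt] := IHi j q ij; rewrite ?qE //.
by exists t; rewrite // pE rootM qt.
Qed.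

Section Diagonal.
Context (K : numClosedFieldType).
Implicit Types (g : {mpoly K[3]}) (m : 'X_{1..3}).

(** Two linear conditions hold on the exponents of g: their sum is e and their weighted
sum is l.  The conditions are independent because the weights are not all equal, so
the differences of exponents are proportional. *)
Lemma support_line e (d : 'I_3 -> K) l g m m' m'' :
    g \is e.-homog -> (exists i j, d i != d j) ->
    (forall n, g@_n != 0 -> \sum_i d i * (n i)%:R = l) ->
    g@_m != 0 -> g@_m' != 0 -> g@_m'' != 0 ->
  ((m o1)%:Z - (m' o1)%:Z) * ((m'' o2)%:Z - (m' o2)%:Z) =
  ((m o2)%:Z - (m' o2)%:Z) * ((m'' o1)%:Z - (m' o1)%:Z).
Proof.
move=> hg dnc weight gm gm' gm''.
have deg n : g@_n != 0 -> (n o0)%:R + (n o1)%:R + (n o2)%:R = e%:R :> K.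
  by move=> /(homog_coeff_neq0 hg) <-; rewrite mdeg3 !natrD.
pose A1 := d o1 - d o0; pose A2 := d o2 - d o0.
have rel n : g@_n != 0 -> A1 * (n o1)%:R + A2 * (n o2)%:R = l - d o0 * e%:R.
  by move=> gn; rewrite -(weight n gn) -(deg n gn) sum_ord3 /A1 /A2; ring.
have A0 : (A1 != 0) || (A2 != 0).
  rewrite -negb_and; apply/negP=> /andP[/eqP/subr0_eq d1 /eqP/subr0_eq d2].
  have dE i : d i = d o0 by move: i; apply: ord3_ind.
  by case: dnc => i [j]; rewrite (dE i) (dE j) eqxx.
apply: (@intr_inj K); rewrite !rmorphM !rmorphB /= -!pmulrn.
apply/eqP; rewrite -subr_eq0; apply/eqP.
set x1 := (m o1)%:R in rel *; set x2 := (m o2)%:R.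
set y1 := (m' o1)%:R; set y2 := (m' o2)%:R.
set z1 := (m'' o1)%:R; set z2 := (m'' o2)%:R.
have rm := rel m gm; have rm' := rel m' gm'; have rm'' := rel m'' gm''.
have E1 : A1 * (x1 - y1) + A2 * (x2 - y2) = 0.
  by rewrite -[RHS](subrr (A1 * y1 + A2 * y2)) {1}rm' -rm; ring.
have E2 : A1 * (z1 - y1) + A2 * (z2 - y2) = 0.
  by rewrite -[RHS](subrr (A1 * y1 + A2 * y2)) {1}rm' -rm''; ring.
case/orP: A0 => A0; apply: (mulfI A0); rewrite mulr0.
  transitivity ((A1 * (x1 - y1) + A2 * (x2 - y2)) * (z2 - y2) -
                (x2 - y2) * (A1 * (z1 - y1) + A2 * (z2 - y2))); first by ring.
  by rewrite E1 E2 mul0r mulr0 subrr.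
transitivity ((x1 - y1) * (A1 * (z1 - y1) + A2 * (z2 - y2)) -
              (A1 * (x1 - y1) + A2 * (x2 - y2)) * (z1 - y1)); first by ring.
by rewrite E1 E2 mul0r mulr0 subrr.
Qed.

(** On the lattice line of the exponents of g, the exponents of x and y in G^m are
constant, so that g(G) is a monomial times g(1, t, 1), and t is chosen to be a
nonzero root of the latter.  In F, the exponents u and v with u p = v r + 1 make the
quotient of the two entries of F(G) equal to that of the variables. *)
Lemma parametrized_monomial_curve e (p r k : nat) g m m' :
    g \is e.-homog -> coprime p r -> (0 < p)%N ->
    (forall n, g@_n != 0 -> (p * n o2 + k = r * n o1 + p * m' o2)%N) ->
    g@_m != 0 -> g@_m' != 0 -> (m' o1 < m o1)%N ->
  parametrized g.
Proof.
move=> hg cop p0 line gm gm' lt1.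
pose h := tnth [tuple 1; 'X : {poly K}; 1].
have hprod n : \prod_i h i ^+ n i = 'X^(n o1).
  by rewrite prod_ord3 /h /tnth /= !expr1n mul1r mulr1.
have eq_line n n' : g@_n != 0 -> g@_n' != 0 -> n o1 = n' o1 -> n = n'.
  move=> gn gn' n1; have n2 : n o2 = n' o2.
    have := line n gn; have := line n' gn'; rewrite n1 => <- /eqP.
    by rewrite eqn_add2r eqn_pmul2l // => /eqP.
  apply/mnmP; apply: ord3_ind => //.
  by have := homog_coeff_neq0 hg gn; rewrite -(homog_coeff_neq0 hg gn') !mdeg3; lia.
have coefE n : g@_n != 0 -> (restrict h g)`_(n o1) = g@_n.
  move=> gn; rewrite (coef_restrict_unique (m0 := n)) => [|n' gn'].
    by rewrite hprod coefXn eqxx mulr1.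
  rewrite hprod coefXn; case: (n o1 =P n' o1) => // /esym n1.
  by rewrite (eq_line n' n) ?eqxx.
have [t t0 /rootP] : exists2 t, t != 0 & root (restrict h g) t.
  by apply: (ex_nonzero_root lt1); rewrite coefE.
rewrite horner_restrict => gt0.
(* Bezout coefficients with u p = v r + 1. *)
have [u v uv _] := egcdnP r p0; rewrite (eqP cop) in uv.
pose x : {mpoly K[2]} := 'X_ord0; pose y : {mpoly K[2]} := 'X_ord_max.
have x0 : x != 0 by rewrite -msupp_eq0 msuppX.
have y0 : y != 0 by rewrite -msupp_eq0 msuppX.
pose G := [tuple x ^+ p * y ^+ r; t *: x ^+ (p + r); y ^+ (p + r)].
pose F : 2.-tuple {mpoly K[3]} :=
  [tuple t ^+ v *: 'X_o0 ^+ (u + v); 'X_o2 ^+ u * 'X_o1 ^+ v].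
have homogXn n (i : 'I_n) k' : ('X_i ^+ k' : {mpoly K[n]}) \is k'.-homog.
  by rewrite -{2}[k']mul1n; apply: dhomogMn; rewrite dhomogX /= mdeg1.
exists G, F, (p + r)%N, (u + v)%N, (t ^+ v *: (x ^+ ((p + r) * v) * y ^+ (r * (u + v)))); split.
- apply: ord3_ind; rewrite /tnth /=; [apply: dhomogM|apply: dhomogZ|]; exact: homogXn.
- by apply: ord2_ind; rewrite /tnth /=; [apply: dhomogZ|apply: dhomogM]; exact: homogXn.
- by rewrite mscalerI negb_or expf_neq0 // mulf_neq0 ?expf_neq0.
- pose a := (p * m' o0 + (p + r) * m' o1)%N; pose b := (r * m' o0 + (p + r) * m' o2)%N.
  transitivity (g.@[fun i => (h i).[t]] *: (x ^+ a * y ^+ b)); last by rewrite gt0 scale0r.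
  rewrite comp_mpolyE mevalE scaler_suml; apply: eq_big_seq => n.
  rewrite mcoeff_msupp => gn; rewrite -scalerA; congr (_ *: _).
  rewrite !prod_ord3 /h /tnth /= !hornerE !expr1n mul1r mulr1.
  rewrite exprZn -scalerAr -scalerAl; congr (_ *: _).
  rewrite !exprMn -!exprM.
  have aE : a = (p * n o0 + (p + r) * n o1)%N.
    have := line n gn; have := line m' gm'.
    by have := homog_coeff_neq0 hg gn; rewrite -(homog_coeff_neq0 hg gm') !mdeg3 /a; nia.
  have bE : b = (r * n o0 + (p + r) * n o2)%N.
    have := line n gn; have := line m' gm'.
    by have := homog_coeff_neq0 hg gn; rewrite -(homog_coeff_neq0 hg gm') !mdeg3 /b; nia.
  by rewrite aE bE !exprD; ring.
- apply: ord2_ind; rewrite /tnth /=.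
    rewrite comp_mpolyZ rmorphXn /= comp_mpolyX_tnth /tnth /= -scalerAl; congr (_ *: _).
    rewrite exprMn -!exprM.
    (* This is where p u = r v + 1 is used. *)
    have -> : (p * (u + v) = (p + r) * v + 1)%N by nia.
    by rewrite exprD expr1 /x; ring.
  rewrite comp_mpolyM !rmorphXn /= !comp_mpolyX_tnth /tnth /= -scalerAl.
  rewrite exprZn -scalerAr -!exprM; congr (_ *: _).
  have -> : ((p + r) * u = r * (u + v) + 1)%N by nia.
  by rewrite [in LHS]exprD expr1 /y; ring.
Qed.

(** The primitive direction of the lattice line is obtained by dividing the differences
of the exponents by their gcd. *)
Lemma parametrized_weighted_pair e (d : 'I_3 -> K) l g m m' :
    g \is e.-homog -> (exists i j, d i != d j) ->
    (forall n, g@_n != 0 -> \sum_i d i * (n i)%:R = l) ->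
    g@_m != 0 -> g@_m' != 0 -> (m' o1 < m o1)%N -> (m' o2 <= m o2)%N ->
  parametrized g.
Proof.
move=> hg dnc weight gm gm' lt1 le2.
pose p0 := (m o1 - m' o1)%N; pose r0 := (m o2 - m' o2)%N; pose D := gcdn p0 r0.
have p0_gt0 : (0 < p0)%N by rewrite subn_gt0.
have D0 : (0 < D)%N by rewrite gcdn_gt0 p0_gt0.
have pE : (p0 = p0 %/ D * D)%N by rewrite divnK ?dvdn_gcdl.
have rE : (r0 = r0 %/ D * D)%N by rewrite divnK ?dvdn_gcdr.
apply: (parametrized_monomial_curve (p := (p0 %/ D)%N) (r := (r0 %/ D)%N)
  (k := (r0 %/ D * m' o1)%N) hg _ _ _ gm gm' lt1).
- by rewrite /coprime -(eqn_pmul2r D0) muln_gcdl -pE -rE mul1n.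
- by rewrite divn_gt0 // dvdn_leq ?dvdn_gcdl.
move=> n gn; apply/eqP; rewrite -(eqn_pmul2r D0) !mulnDl.
rewrite !(mulnAC _ _ D) -pE -rE; apply/eqP.
have := support_line hg dnc weight gm gm' gn.
rewrite /p0 /r0; move: (m o1) (m o2) (m' o1) (m' o2) (n o1) (n o2) lt1 le2.
by move=> a1 a2 b1 b2 n1 n2 lt1 le2; nia.
Qed.

(** With two distinct monomials in g, a permutation of the variables gives their
difference the signs required by the parametrization. *)
Lemma parametrized_weighted e (d : 'I_3 -> K) l g :
    g \is e.-homog -> (exists i j, d i != d j) ->
    (forall n, g@_n != 0 -> \sum_i d i * (n i)%:R = l) ->
    g != 0 -> g \isn't a GRing.unit ->
  parametrized g.
Proof.
move=> hg dnc weight g0 gU.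
have [m gm] : exists m, g@_m != 0.
  by exists (mlead g); rewrite mleadc_eq0.
have [[m' [gm' mm']]|single] := classic (exists m', g@_m' != 0 /\ m != m').
  have degE : mdeg m = mdeg m' by rewrite !(homog_coeff_neq0 hg).
  have [i [j [ij lt_ij]]] := ex_increasing_pair degE mm'.
  have [s [si sj]] := ex_perm2 ij (isT : o1 != o2).
  apply: (@parametrized_msym _ _ s).
  have hsg : msym s g \is e.-homog.
    apply/dhomogP=> n; rewrite mcoeff_msupp mcoeff_sym => /(homog_coeff_neq0 hg) /= <-.
    by rewrite mdeg_mperm.
  (* The weights follow the permutation of the variables. *)
  pose d' k := d (s^-1%g k).
  have dnc' : exists i j, d' i != d' j.
    by case: dnc => k [k' dk]; exists (s k), (s k'); rewrite /d' !permK.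
  have weight' n : (msym s g)@_n != 0 -> \sum_k d' k * (n k)%:R = l.
    rewrite mcoeff_sym => /weight <-; rewrite (reindex_inj (@perm_inj _ s)).
    by apply: eq_bigr => k _; rewrite /d' permK mnmE.
  pose perm_mon (n : 'X_{1..3}) : 'X_{1..3} := [multinom n (s^-1%g k) | k < 3].
  have coef_perm n : (msym s g)@_(perm_mon n) = g@_n.
    rewrite mcoeff_sym; congr (_@__); apply/mnmP=> k.
    by rewrite !mnmE permK.
  have perm1 n : perm_mon n o1 = n i by rewrite mnmE -si permK.
  have perm2 n : perm_mon n o2 = n j by rewrite mnmE -sj permK.
  have pair := parametrized_weighted_pair hsg dnc' weight'.
  by case: lt_ij => -[lt_i le_j]; [apply: (pair (perm_mon m) (perm_mon m')) |
    apply: (pair (perm_mon m') (perm_mon m))]; rewrite ?coef_perm ?perm1 ?perm2.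
have [i mi] : exists i, (0 < m i)%N.
  apply/existsP; apply: contraNT gU => /existsPn m0; apply: homog0_unit => //.
  have e0 : e = 0%N.
    rewrite -(homog_coeff_neq0 hg gm) mdegE big1 // => i _.
    by apply/eqP; rewrite -leqn0 leqNgt.
  by move: hg; rewrite e0.
apply: (@parametrized_coordinate_line _ _ i) => n gn; suff <- : m = n by [].
by apply/eqP; apply: contra_notT single => mn; exists n.
Qed.

End Diagonal.

(** * Components of a curve with a linear syzygy *)

Lemma parametrized_eigen (K : numClosedFieldType) e (M : 'M[K]_3) l (g : {mpoly K[3]}) :
    g \is e.-homog -> irreducible g -> (forall a, M <> a%:M) ->
    linear_field M g = l *: g ->
  parametrized g.
Proof.
move=> hg irr Mns eig.
have change L N : L \in unitmx -> L *m M = N *m L ->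
  (forall h, h \is e.-homog -> h != 0 -> h \isn't a GRing.unit ->
    linear_field N h = l *: h -> parametrized h) -> parametrized g.
  move=> UL LM par; have UL' : invmx L \in unitmx by rewrite unitmx_inv.
  apply: (parametrized_linear_change UL').
  have [h0 hU _] := irreducible_linear_change UL' irr.
  apply: par => //.
    by rewrite -[e]mul1n; apply: comp_homog => // i; apply: linear_forms_homog.
  (* The matrix of the field in the new coordinates is N = L M L^-1. *)
  rewrite (linear_field_change (M := M)) ?eig ?comp_mpolyZ //.
  by rewrite -[M](mulKmx UL) LM -mulmxA mulmxK.
have [[L [d [UL LM]]]|[L [a [c [b [UL cb LM]]]]]] := linear_normal_form M.
  apply: (change L _ UL LM) => h hh h0 hU eigh.
  apply: (parametrized_weighted (d := d 0) (l := l) hh) => //.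
    apply: NNPP => dc; apply: (Mns (d 0 o0)); rewrite -[M](mulKmx UL) LM.
    have -> : diag_mx d = (d 0 o0)%:M.
      apply/matrixP=> i j; rewrite !mxE; congr (_ *+ _).
      by apply/eqP; apply: contra_notT dc => dij; exists i, o0.
    by rewrite -scalar_mxC mulKmx.
  move=> n hn; have := congr1 (mcoeff n) eigh.
  by rewrite mcoeff_diag_field mcoeffZ => /(mulIf hn).
apply: (change L _ UL LM) => h hh h0 hU eigh.
exact: parametrized_nilpotent hh (jordan_eigen_nilpotent hh cb eigh) h0 hU.
Qed.

Lemma linear_syzygy_rational (K : numClosedFieldType) (d d2 : nat)
    (f g : {mpoly K[3]}) :
  (0 < d)%N -> reduced_curve d f -> has_exponents f 1 d2 ->
  irreducible_component f g -> rational_curve g.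
Proof.
move=> d0 [f0 hfd sqf] [_ [b [[bS _ b_free] b1 _]]] [[e hge] irr gf].
pose M : 'M[K]_3 := \matrix_(i, j) (b ord0 0 i)@_U_(j).
have bE i : tnth (linear_forms M) i = b ord0 0 i.
  rewrite (homog1_linear_form (b1 i)) tnth_mktuple.
  by apply: eq_bigr => j _; rewrite mxE.
have Mf : linear_field M f = 0.
  by rewrite -[RHS](bS ord0); apply: eq_bigr => i _; rewrite bE.
have Mns a : M <> a%:M.
  move=> Ma; have a0 : a = 0.
    by apply: (scalar_field_killing hfd f0 d0); rewrite -Ma.
  have bz : b ord0 = 0.
    by apply/rowP=> i; rewrite mxE -bE Ma a0 tnth_mktuple big1 // => j _;
      rewrite mxE mul0rn scale0r.
  have := b_free (fun i => (i == ord0)%:R); rewrite sum_ord2 bz scaler0 add0r.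
  by rewrite scale0r => /(_ erefl ord0)/eqP; rewrite oner_eq0.
have [l eig] := linear_field_eigen sqf irr gf Mf.
have [G [F par]] := parametrized_eigen hge irr Mns eig.
exact: parametrized_rational irr par.
Qed.

Theorem corollary3p4 (R : realType) (d d1 d2 : nat) (f : {mpoly R[i][3]})
    (hf : reduced_curve d f) (hd : (3 <= d)%N)
    (hfree : free_curve f) (hexp : has_exponents f d1 d2) (hd1 : d1 = 1%N)
    (g : {mpoly R[i][3]}) (hg : irreducible_component f g) :
  rational_curve g.
Proof.
rewrite hd1 in hexp.
exact: linear_syzygy_rational (leq_trans _ hd) hf hexp hg.
Qed.
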